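(* Let $\mathcal{E}$ be an elementary topos equipped with an interval object $\mathbb{I}$ with connections and a class $\mathcal{C}$ of monomorphisms satisfying the axioms described in the context. Let $\mathcal{E}_f$ be the full subcategory of $\mathcal{E}$ on the fibrant objects. Then $\mathcal{E}_f$ carries a Quillen model structure whose cofibrations are the morphisms of $\mathcal{E}_f$ belonging to $\mathcal{C}$, whose fibrations are the morphisms of $\mathcal{E}_f$ that are fibrations in the sense below, and whose weak equivalences are the homotopy equivalences.
   Context: Setting: $\mathcal{E}$ is an elementary topos. $\mathbb{I}$ is an object with a monomorphism $[\partial_0,\partial_1]:1+1\to\mathbb{I}$ and maps (''connections'') $\land,\lor:\mathbb{I}\times\mathbb{I}\to\mathbb{I}$ satisfying $i\land 0=0\land i=0$, $i\land 1=1\land i=i$, $i\lor 0=0\lor i=i$, $i\lor 1=1\lor i=1$ (writing $0,1$ for $\partial_0,\partial_1$). $\mathcal{C}$ is a class of monomorphisms (the ''cofibrations'') such that: (a) $\mathcal{C}$ is a dominance, i.e. contains all isomorphisms, is closed under composition and under pullback, and the category of maps in $\mathcal{C}$ with pullback squares between them has a terminal object (equivalently $\mathcal{C}$ is the class of monos classified by a subobject $\Sigma\subseteq\Omega$ with $\top\in\Sigma$ and $p\in\Sigma\wedge(p\Rightarrow q\in\Sigma)\Rightarrow p\wedge q\in\Sigma$); (b) $\mathcal{C}$ is closed under finite unions (all maps $0\to X$ are in $\mathcal{C}$ and the union of two $\mathcal{C}$-subobjects is a $\mathcal{C}$-subobject); (c) $[\partial_0,\partial_1]\in\mathcal{C}$.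 For $f:A\to B$, $g:C\to D$, the Leibniz product $f\hat\otimes g:(B\times C)\cup_{A\times C}(A\times D)\to B\times D$ is the map induced from the pushout of $f\times 1$ and $1\times g$. A map has the right lifting property (RLP) against $u$ if every commutative square from $u$ to it has a diagonal filler. A trivial fibration is a map with the RLP against all maps in $\mathcal{C}$. A fibration is a map with the RLP against all maps $\partial_i\hat\otimes u$ with $u\in\mathcal{C}$, $i\in\{0,1\}$ (here $\partial_i:1\to\mathbb{I}$). An object $X$ is fibrant if $X\to 1$ is a fibration. Two maps $f,g:B\to A$ are homotopic if there is $H:\mathbb{I}\times B\to A$ with $H(\partial_0\times B)=f$, $H(\partial_1\times B)=g$. A homotopy equivalence is a map $f:B\to A$ with some $g:A\to B$ such that $gf$ is homotopic to $1_B$ and $fg$ to $1_A$. *)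

(* Defs.v *)
Set Implicit Arguments.
Unset Strict Implicit.
Unset Printing Implicit Defensive.

Declare Scope topos_scope.
Delimit Scope topos_scope with topos.
Local Open Scope topos_scope.

Record Category := {
  Ob :> Type;
  Hom : Ob -> Ob -> Type;
  idm : forall X : Ob, Hom X X;
  comp : forall X Y Z : Ob, Hom Y Z -> Hom X Y -> Hom X Z;
  comp_idl : forall (X Y : Ob) (f : Hom X Y), comp (idm Y) f = f;
  comp_idr : forall (X Y : Ob) (f : Hom X Y), comp f (idm X) = f;
  comp_assoc : forall (W X Y Z : Ob) (h : Hom Y Z) (g : Hom X Y) (f : Hom W X),
    comp h (comp g f) = comp (comp h g) f
}.

Arguments Hom {c} X Y.
Arguments idm {c} X.
Arguments comp {c X Y Z} g f.

Notation "g ∘ f" := (comp g f) (at level 40, left associativity) : topos_scope.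

Definition MorClass (K : Category) : Type := forall X Y : K, Hom X Y -> Prop.

Section Notions.
Variable K : Category.

Definition monic (X Y : K) (m : Hom X Y) : Prop :=
  forall (Z : K) (f g : Hom Z X), m ∘ f = m ∘ g -> f = g.

Definition is_iso (X Y : K) (f : Hom X Y) : Prop :=
  exists g : Hom Y X, g ∘ f = idm X /\ f ∘ g = idm Y.

Definition is_initial (Z : K) : Prop :=
  forall X : K, exists! f : Hom Z X, True.

Definition is_coproduct (A B S : K) (inl : Hom A S) (inr : Hom B S) : Prop :=
  forall (X : K) (f : Hom A X) (g : Hom B X),
    exists! h : Hom S X, h ∘ inl = f /\ h ∘ inr = g.

Definition is_equalizer (Q A B : K) (f g : Hom A B) (e : Hom Q A) : Prop :=
  f ∘ e = g ∘ e /\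
  forall (Z : K) (h : Hom Z A), f ∘ h = g ∘ h -> exists! k : Hom Z Q, e ∘ k = h.

(* P -q-> B
   |p     |g
   A -f-> X  *)
Definition is_pullback (P A B X : K) (f : Hom A X) (g : Hom B X)
    (p : Hom P A) (q : Hom P B) : Prop :=
  f ∘ p = g ∘ q /\
  forall (Z : K) (a : Hom Z A) (b : Hom Z B), f ∘ a = g ∘ b ->
    exists! h : Hom Z P, p ∘ h = a /\ q ∘ h = b.

Definition is_pushout (X A B P : K) (f : Hom X A) (g : Hom X B)
    (p : Hom A P) (q : Hom B P) : Prop :=
  p ∘ f = q ∘ g /\
  forall (Z : K) (a : Hom A Z) (b : Hom B Z), a ∘ f = b ∘ g ->
    exists! h : Hom P Z, h ∘ p = a /\ h ∘ q = b.

Definition sub_le (X A B : K) (m : Hom A X) (n : Hom B X) : Prop :=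
  exists k : Hom A B, n ∘ k = m.

(* w represents the join of m and n in the poset of subobjects of X. *)
Definition is_union (X A B U : K) (m : Hom A X) (n : Hom B X) (w : Hom U X) : Prop :=
  monic w /\ sub_le m w /\ sub_le n w /\
  forall (V : K) (v : Hom V X), monic v -> sub_le m v -> sub_le n v -> sub_le w v.

(* p has the right lifting property against u. *)
Definition rlp (A B X Y : K) (u : Hom A B) (p : Hom X Y) : Prop :=
  forall (t : Hom A X) (b : Hom B Y), p ∘ t = b ∘ u ->
    exists d : Hom B X, d ∘ u = t /\ p ∘ d = b.

Definition is_retract (A B X Y : K) (f : Hom A B) (g : Hom X Y) : Prop :=
  exists (s : Hom A X) (r : Hom X A) (s' : Hom B Y) (r' : Hom Y B),
    r ∘ s = idm A /\ r' ∘ s' = idm B /\ g ∘ s = s' ∘ f /\ f ∘ r = r' ∘ g.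

Definition retract_closed (L : MorClass K) : Prop :=
  forall (A B X Y : K) (f : Hom A B) (g : Hom X Y),
    is_retract f g -> L X Y g -> L A B f.

(* Quillen's axioms for a (closed) model structure given by three classes of
   maps on a category, which is not itself required to be finitely complete or
   cocomplete. *)
Record model_structure (Cof Fib W : MorClass K) : Prop := {
  ms_two_of_three_comp : forall (X Y Z : K) (f : Hom X Y) (g : Hom Y Z),
    W _ _ f -> W _ _ g -> W _ _ (g ∘ f);
  ms_two_of_three_left : forall (X Y Z : K) (f : Hom X Y) (g : Hom Y Z),
    W _ _ f -> W _ _ (g ∘ f) -> W _ _ g;
  ms_two_of_three_right : forall (X Y Z : K) (f : Hom X Y) (g : Hom Y Z),
    W _ _ g -> W _ _ (g ∘ f) -> W _ _ f;
  ms_retract_cof : retract_closed Cof;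
  ms_retract_fib : retract_closed Fib;
  ms_retract_weq : retract_closed W;
  ms_lift_cof_tfib : forall (A B X Y : K) (u : Hom A B) (p : Hom X Y),
    Cof _ _ u -> Fib _ _ p -> W _ _ p -> rlp u p;
  ms_lift_tcof_fib : forall (A B X Y : K) (u : Hom A B) (p : Hom X Y),
    Cof _ _ u -> W _ _ u -> Fib _ _ p -> rlp u p;
  ms_factor_cof_tfib : forall (X Y : K) (f : Hom X Y),
    exists (Z : K) (u : Hom X Z) (p : Hom Z Y),
      Cof _ _ u /\ Fib _ _ p /\ W _ _ p /\ p ∘ u = f;
  ms_factor_tcof_fib : forall (X Y : K) (f : Hom X Y),
    exists (Z : K) (u : Hom X Z) (p : Hom Z Y),
      Cof _ _ u /\ W _ _ u /\ Fib _ _ p /\ p ∘ u = f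
}.

Definition full_subcategory (P : K -> Prop) : Category := {|
  Ob := {X : K | P X};
  Hom := fun X Y => Hom (proj1_sig X) (proj1_sig Y);
  idm := fun X => idm (proj1_sig X);
  comp := fun X Y Z g f => g ∘ f;
  comp_idl := fun X Y f => comp_idl f;
  comp_idr := fun X Y f => comp_idr f;
  comp_assoc := fun W X Y Z h g f => comp_assoc h g f
|}.

Definition restrict (P : K -> Prop) (L : MorClass K) : MorClass (full_subcategory P) :=
  fun X Y f => L (proj1_sig X) (proj1_sig Y) f.

End Notions.

(* An elementary topos: (chosen) finite limits, exponentials and a subobject
   classifier. Finite colimits are a consequence and are not part of the
   structure; below they are referred to by their universal properties. *)
Record Topos := {
  topos_cat :> Category;

  one : topos_cat;
  bang : forall X : topos_cat, Hom X one;
  bang_unique : forall (X : topos_cat) (f : Hom X one), f = bang X;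

  prod : topos_cat -> topos_cat -> topos_cat;
  pr1 : forall A B : topos_cat, Hom (prod A B) A;
  pr2 : forall A B : topos_cat, Hom (prod A B) B;
  pair : forall Z A B : topos_cat, Hom Z A -> Hom Z B -> Hom Z (prod A B);
  pr1_pair : forall (Z A B : topos_cat) (f : Hom Z A) (g : Hom Z B),
    pr1 A B ∘ pair f g = f;
  pr2_pair : forall (Z A B : topos_cat) (f : Hom Z A) (g : Hom Z B),
    pr2 A B ∘ pair f g = g;
  pair_unique : forall (Z A B : topos_cat) (h : Hom Z (prod A B)),
    h = pair (pr1 A B ∘ h) (pr2 A B ∘ h);

  equ : forall A B : topos_cat, Hom A B -> Hom A B -> topos_cat;
  equ_map : forall (A B : topos_cat) (f g : Hom A B), Hom (equ f g) A;
  equ_is_equalizer : forall (A B : topos_cat) (f g : Hom A B),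
    is_equalizer f g (equ_map f g);

  exp : topos_cat -> topos_cat -> topos_cat;
  ev : forall A B : topos_cat, Hom (prod (exp A B) A) B;
  exp_universal : forall (Z A B : topos_cat) (f : Hom (prod Z A) B),
    exists! h : Hom Z (exp A B), ev A B ∘ pair (h ∘ pr1 Z A) (pr2 Z A) = f;

  Omega : topos_cat;
  truth : Hom one Omega;
  classify : forall (A X : topos_cat) (m : Hom A X), monic m ->
    exists! chi : Hom X Omega, is_pullback chi truth m (bang A)
}.

Arguments one {t}.
Arguments bang {t} X.
Arguments prod {t} A B.
Arguments pr1 {t A B}.
Arguments pr2 {t A B}.
Arguments pair {t Z A B} f g.

Notation "A × B" := (prod A B) (at level 40, left associativity) : topos_scope.
Notation "⟨ f , g ⟩" := (pair f g) (at level 0, f at level 99, g at level 99) : topos_scope.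

Definition prod_map (E : Topos) (A B C D : E) (f : Hom A B) (g : Hom C D) :
    Hom (A × C) (B × D) :=
  ⟨f ∘ pr1, g ∘ pr2⟩.

(* w is the map (B × C) ∪_{A × C} (A × D) -> B × D induced out of some pushout. *)
Definition is_leibniz_product (E : Topos) (A B C D P : E)
    (f : Hom A B) (g : Hom C D) (w : Hom P (B × D)) : Prop :=
  exists (j1 : Hom (B × C) P) (j2 : Hom (A × D) P),
    is_pushout (prod_map f (idm C)) (prod_map (idm A) g) j1 j2 /\
    w ∘ j1 = prod_map (idm B) g /\
    w ∘ j2 = prod_map f (idm D).

(* two, with its two injections, is the coproduct 1 + 1. *)
Record Interval (E : Topos) := {
  two : E;
  two_inl : Hom one two;
  two_inr : Hom one two;
  two_is_coproduct : is_coproduct two_inl two_inr;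

  int :> Ob E;
  bdry : Hom two int;
  bdry_monic : monic bdry;

  meet : Hom (int × int) int;
  join : Hom (int × int) int;
  (* the endpoints as constant maps int -> int *)
  int0 := (bdry ∘ two_inl) ∘ bang int;
  int1 := (bdry ∘ two_inr) ∘ bang int;
  meet_x0 : meet ∘ ⟨idm int, int0⟩ = int0;
  meet_0x : meet ∘ ⟨int0, idm int⟩ = int0;
  meet_x1 : meet ∘ ⟨idm int, int1⟩ = idm int;
  meet_1x : meet ∘ ⟨int1, idm int⟩ = idm int;
  join_x0 : join ∘ ⟨idm int, int0⟩ = idm int;
  join_0x : join ∘ ⟨int0, idm int⟩ = idm int;
  join_x1 : join ∘ ⟨idm int, int1⟩ = int1;
  join_1x : join ∘ ⟨int1, idm int⟩ = int1
}.

(* The endpoint inclusions: false is 0, true is 1. *)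
Definition endpoint (E : Topos) (I : Interval E) (i : bool) : Hom one I :=
  bdry I ∘ (if i then two_inr I else two_inl I).

Record is_dominance (E : Topos) (C : MorClass E) : Prop := {
  dom_monic : forall (A B : E) (u : Hom A B), C _ _ u -> monic u;
  dom_iso : forall (A B : E) (u : Hom A B), is_iso u -> C _ _ u;
  dom_comp : forall (X Y Z : E) (u : Hom X Y) (v : Hom Y Z),
    C _ _ u -> C _ _ v -> C _ _ (v ∘ u);
  dom_pullback : forall (P A B X : E) (f : Hom A X) (u : Hom B X)
      (p : Hom P A) (q : Hom P B),
    is_pullback f u p q -> C _ _ u -> C _ _ p;
  (* terminal object of the category of maps in C and pullback squares *)
  dom_terminal : exists (T0 T1 : E) (t : Hom T0 T1), C _ _ t /\
    forall (A B : E) (u : Hom A B), C _ _ u ->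
      exists! ab : Hom A T0 * Hom B T1, is_pullback (snd ab) t u (fst ab)
}.

Record cofibration_class (E : Topos) (I : Interval E) (C : MorClass E) : Prop := {
  cof_dominance : is_dominance C;
  cof_initial : forall (Z X : E) (u : Hom Z X), is_initial Z -> C _ _ u;
  cof_union : forall (X A B U : E) (m : Hom A X) (n : Hom B X) (w : Hom U X),
    C _ _ m -> C _ _ n -> is_union m n w -> C _ _ w;
  cof_bdry : C _ _ (bdry I)
}.

Section Homotopy.
Variables (E : Topos) (I : Interval E).

Definition fibration (C : MorClass E) : MorClass E := fun X Y p =>
  forall (i : bool) (A B : E) (u : Hom A B) (P : E) (w : Hom P (I × B)),
    C _ _ u -> is_leibniz_product (endpoint I i) u w -> rlp w p.

Definition fibrant (C : MorClass E) (X : E) : Prop := fibration C (bang X).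

(* endpoint i × B, precomposed with the isomorphism B ≅ 1 × B *)
Definition at_end (i : bool) (B : E) : Hom B (I × B) :=
  ⟨endpoint I i ∘ bang B, idm B⟩.

Definition homotopic (B A : E) (f g : Hom B A) : Prop :=
  exists H : Hom (I × B) A, H ∘ at_end false B = f /\ H ∘ at_end true B = g.

Definition homotopy_equivalence : MorClass E := fun B A f =>
  exists g : Hom A B, homotopic (g ∘ f) (idm B) /\ homotopic (f ∘ g) (idm A).

End Homotopy.

(* Main.v *)
(** Maps are handled through generalized elements, and the internal logic of the topos
    through the predicates on generalized elements that are represented by a map to
    [Omega].  The union of two subobjects is defined impredicatively; maps agreeing on
    the intersection glue along it, because the family of subsets they determine
    consists of singletons on either part.

    Up to the pushout defining the Leibniz product, a fibration is a map along which
    homotopies lift relative to every cofibration.  By gluing, a partial lift may be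
    prescribed on the faces of a box as well, and three box fillings give the model
    structure.  A fibration which is a homotopy equivalence has a strict section [s]
    and, thanks to the connection [\/], a vertical homotopy [s f ~ 1], so it lifts
    against every cofibration.  Dually, a cofibration between fibrant objects which is
    a homotopy equivalence is a strong deformation retract, so it lifts against every
    fibration.  Finally [X ×_Y Y^I -> Y] is a fibration, and [X -> X ×_Y Y^I] is a
    homotopy equivalence thanks to the connection [/\].  Cofibrations and trivial
    fibrations form a factorization system through the fibrewise classifier of partial
    maps with domain in [C]; combined with the mapping path object it yields the other
    factorization. *)

From Corelib Require Import ssreflect ssrbool.
From Stdlib Require Import Setoid.
Require Import Defs.

Set Implicit Arguments.
Unset Strict Implicit.
Unset Printing Implicit Defensive.
Local Open Scope topos_scope.

(* [x ∈ m] also reads: the generalized element [x] belongs to the subobject [m]. *)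
Local Notation "x ∈ m" := (sub_le x m) (at level 70, no associativity) : topos_scope.

Section Categories.
Variable K : Category.
Implicit Types A B P S T X Y Z : K.

Lemma comp_assocr W X Y Z (h : Hom Y Z) (g : Hom X Y) (f : Hom W X) :
  h ∘ g ∘ f = h ∘ (g ∘ f).
Proof. by rewrite comp_assoc. Qed.

Lemma hom_ext X Y (f g : Hom X Y) :
  (forall S (x : Hom S X), f ∘ x = g ∘ x) -> f = g.
Proof. by move=> /(_ X (idm X)); rewrite !comp_idr. Qed.

Lemma sub_le_comp A X S S' (m : Hom A X) (x : Hom S X) (g : Hom S' S) :
  x ∈ m -> x ∘ g ∈ m.
Proof. by case=> a <-; exists (a ∘ g); rewrite comp_assoc. Qed.

Lemma sub_le_trans A B S X (x : Hom S X) (m : Hom A X) (n : Hom B X) :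
  x ∈ m -> m ∈ n -> x ∈ n.
Proof. by move=> [a <-] [b <-]; exists (b ∘ a); rewrite comp_assoc. Qed.

Lemma initial_ext Z X (f g : Hom Z X) : is_initial Z -> f = g.
Proof. by move=> /(_ X) [h [_ u]]; rewrite -(u f) // (u g). Qed.

Lemma coproduct_ext A B S Z (i : Hom A S) (j : Hom B S) (h k : Hom S Z) :
  is_coproduct i j -> h ∘ i = k ∘ i -> h ∘ j = k ∘ j -> h = k.
Proof.
move=> ij ei ej; have [l [_ u]] := ij Z (h ∘ i) (h ∘ j).
by rewrite -(u h) // (u k).
Qed.

Lemma coproduct_sym A B S (i : Hom A S) (j : Hom B S) :
  is_coproduct i j -> is_coproduct j i.
Proof.
move=> ij X f g; case: (ij X g f) => h [[hi hj] u]; exists h; split=> //.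
by move=> k [kj ki]; apply: u.
Qed.

Lemma pushout_ext A B P X Z (f : Hom X A) (g : Hom X B) (p : Hom A P) (q : Hom B P)
    (h k : Hom P Z) :
  is_pushout f g p q -> h ∘ p = k ∘ p -> h ∘ q = k ∘ q -> h = k.
Proof.
move=> [e po] ep eq; have [|l [_ u]] := po Z (h ∘ p) (h ∘ q).
  by rewrite !comp_assocr e.
by rewrite -(u h) // (u k).
Qed.

Lemma idm_monic X : monic (idm X).
Proof. by move=> Z a b; rewrite !comp_idl. Qed.

Lemma monic_comp X Y Z (f : Hom X Y) (g : Hom Y Z) :
  monic f -> monic g -> monic (g ∘ f).
Proof. by move=> mf mg W a b; rewrite !comp_assocr => /mg /mf. Qed.

Lemma pullback_ext P A B X Z (f : Hom A X) (g : Hom B X) (p : Hom P A) (q : Hom P B)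
    (h k : Hom Z P) :
  is_pullback f g p q -> p ∘ h = p ∘ k -> q ∘ h = q ∘ k -> h = k.
Proof.
move=> [e pb] ep eq; have [|l [_ u]] := pb Z (p ∘ h) (q ∘ h).
  by rewrite !comp_assoc e.
by rewrite -(u h) // (u k).
Qed.

Lemma monic_pullback P A B X (f : Hom A X) (g : Hom B X) (p : Hom P A) (q : Hom P B) :
  is_pullback f g p q -> monic g -> monic p.
Proof.
move=> pb mg Z a b eab; apply: (pullback_ext pb) => //; have [e _] := pb.
by apply: mg; rewrite !comp_assoc -e !comp_assocr eab.
Qed.

Lemma pullback_restrict P A B C X (f : Hom A X) (g : Hom B X) (v : Hom C A)
    (k : Hom P C) (q : Hom P B) :
  monic v -> is_pullback f g (v ∘ k) q -> is_pullback (f ∘ v) g k q.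
Proof.
move=> mv [e pb]; split; first by rewrite comp_assocr.
move=> Z a b eab; have [|h [[eva ehb] u]] := pb Z (v ∘ a) b.
  by rewrite comp_assoc.
exists h; split; first by split=> //; apply: mv; rewrite comp_assoc.
by move=> h' [ka qb]; apply: u; rewrite comp_assocr ka.
Qed.

Lemma retract_pullback A B X Y (f : Hom A B) (g : Hom X Y) :
  monic g -> is_retract f g ->
  exists (s : Hom A X) (s' : Hom B Y), is_pullback s' g f s.
Proof.
move=> mg [s [r [s' [r' [rs [rs' [gs fr]]]]]]]; exists s, s'; split=> // Z a b e.
have fa : f ∘ (r ∘ b) = a by rewrite comp_assoc fr comp_assocr -e comp_assoc rs' comp_idl.
exists (r ∘ b); split.
  by split=> //; apply: mg; rewrite comp_assoc gs comp_assocr fa.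
by move=> h [_ <-]; rewrite comp_assoc rs comp_idl.
Qed.

Lemma rlp_comp A B X Y Z (u : Hom A B) (p : Hom X Y) (q : Hom Y Z) :
  rlp u p -> rlp u q -> rlp u (q ∘ p).
Proof.
move=> up uq t b e; have [|d [du qd]] := uq (p ∘ t) b; first by rewrite comp_assoc.
have [d' [d'u pd']] := up t d (eq_sym du).
by exists d'; rewrite comp_assocr pd'.
Qed.

Lemma rlp_retract U V A B X Y (u : Hom U V) (f : Hom A B) (g : Hom X Y) :
  is_retract f g -> rlp u g -> rlp u f.
Proof.
move=> [s [r [s' [r' [rs [rs' [gs fr]]]]]]] ug t b e.
have [|d [du gd]] := ug (s ∘ t) (s' ∘ b); first by rewrite comp_assoc gs !comp_assocr e.
exists (r ∘ d); split; first by rewrite comp_assocr du comp_assoc rs comp_idl.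
by rewrite comp_assoc fr comp_assocr gd comp_assoc rs' comp_idl.
Qed.

Lemma restrict_retract_closed (Q : K -> Prop) (L : MorClass K) :
  retract_closed L -> retract_closed (@restrict K Q L).
Proof.
move=> cL A B X Y f g fg.
exact: (cL (proj1_sig A) (proj1_sig B) (proj1_sig X) (proj1_sig Y)).
Qed.

Definition classifies T0 T1 A X (t : Hom T0 T1) (c : Hom X T1) (m : Hom A X) : Prop :=
  forall S (x : Hom S X), c ∘ x ∈ t <-> x ∈ m.

Lemma pullback_classifies T0 T1 A X (t : Hom T0 T1) (c : Hom X T1) (m : Hom A X)
    (e : Hom A T0) :
  is_pullback c t m e -> classifies t c m.
Proof.
move=> [ce pb] S x; split; last first.
  by case=> a <-; exists (e ∘ a); rewrite !comp_assoc ce.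
by case=> a ea; have [h [[mh _] _]] := pb S x a (eq_sym ea); exists h.
Qed.

Lemma classifies_pullback T0 T1 A X (t : Hom T0 T1) (c : Hom X T1) (m : Hom A X) :
  monic t -> monic m -> classifies t c m -> exists e, is_pullback c t m e.
Proof.
move=> mt mm cm.
have [e te] : c ∘ m ∈ t by apply/cm; exists (idm A); rewrite comp_idr.
exists e; split=> // S x a eca; have [h mh] : x ∈ m by apply/cm; exists a.
exists h; split; last by move=> h' [mh' _]; apply: mm; rewrite mh mh'.
by split=> //; apply: mt; rewrite comp_assoc te comp_assocr mh.
Qed.

Record is_classifier (M : MorClass K) T0 T1 (t : Hom T0 T1) : Prop := {
  classifier_mem : M T0 T1 t;
  classifier_monic : monic t;
  classifier_char : forall A X (m : Hom A X), M A X m ->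
    exists c, classifies t c m;
  classifier_comprehension : forall X (c : Hom X T1),
    exists A (m : Hom A X), M A X m /\ classifies t c m;
  classifier_ext : forall X (c c' : Hom X T1),
    (forall S (x : Hom S X), c ∘ x ∈ t <-> c' ∘ x ∈ t) -> c = c'
}.

Lemma classifier_true_unique (M : MorClass K) T0 T1 (t : Hom T0 T1) X (c c' : Hom X T1) :
  is_classifier M t -> c ∈ t -> c' ∈ t -> c = c'.
Proof.
by move=> tM ct ct'; apply: (classifier_ext tM) => S x; split=> _; apply: sub_le_comp.
Qed.

End Categories.

Section Products.
Variable E : Topos.
Implicit Types A B S T X Y Z : E.

Lemma one_ext X (f g : Hom X (one : E)) : f = g.
Proof. by rewrite (bang_unique f) (bang_unique g). Qed.

Lemma bang_comp Z X (f : Hom Z X) : bang X ∘ f = bang Z.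
Proof. exact: bang_unique. Qed.

Lemma pair_comp Z' Z A B (f : Hom Z A) (g : Hom Z B) (h : Hom Z' Z) :
  ⟨f, g⟩ ∘ h = ⟨f ∘ h, g ∘ h⟩.
Proof. by rewrite [LHS]pair_unique !comp_assoc pr1_pair pr2_pair. Qed.

Lemma pair_pr A B : ⟨pr1, pr2⟩ = idm (A × B).
Proof. by rewrite [RHS]pair_unique !comp_idr. Qed.

Lemma pair_pr_comp Z A B (h : Hom Z (A × B)) : ⟨pr1 ∘ h, pr2 ∘ h⟩ = h.
Proof. by rewrite -pair_unique. Qed.

Lemma pair_inj Z A B (f f' : Hom Z A) (g g' : Hom Z B) :
  ⟨f, g⟩ = ⟨f', g'⟩ -> f = f' /\ g = g'.
Proof.
move=> e; split.
- by rewrite -(pr1_pair f g) e pr1_pair.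
- by rewrite -(pr2_pair f g) e pr2_pair.
Qed.

Lemma pair_ext Z A B (h k : Hom Z (A × B)) :
  pr1 ∘ h = pr1 ∘ k -> pr2 ∘ h = pr2 ∘ k -> h = k.
Proof. by move=> e1 e2; rewrite (pair_unique h) (pair_unique k) e1 e2. Qed.

Lemma prod_hom_ext A B X (f g : Hom (A × B) X) :
  (forall S (a : Hom S A) (b : Hom S B), f ∘ ⟨a, b⟩ = g ∘ ⟨a, b⟩) -> f = g.
Proof. by move=> e; apply: hom_ext => S x; rewrite -(pair_pr_comp x). Qed.

Lemma prod_mapE A B C D (f : Hom A B) (g : Hom C D) :
  prod_map f g = ⟨f ∘ pr1, g ∘ pr2⟩.
Proof. by []. Qed.

End Products.

#[local] Hint Rewrite comp_assocr comp_idl comp_idr bang_comp pair_comp pr1_pair pr2_pair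
  pair_pr pair_pr_comp prod_mapE : cat.

Local Tactic Notation "cat" := autorewrite with cat.
Local Ltac naturality := move=> ? ? ? ?; by cat.

Section LimitsAndExponentials.
Variable E : Topos.
Implicit Types A B P S T X Y Z : E.

Lemma equ_monic X Y (f g : Hom X Y) : monic (equ_map f g).
Proof.
move=> Z a b e; case: (equ_is_equalizer f g) => ef u.
have [|k [_ uk]] := u Z (equ_map f g ∘ a); first by rewrite comp_assoc ef comp_assocr.
by rewrite -(uk a) // -(uk b).
Qed.

Lemma in_equ X Y (f g : Hom X Y) S (x : Hom S X) :
  x ∈ equ_map f g <-> f ∘ x = g ∘ x.
Proof.
case: (equ_is_equalizer f g) => ef u; split.
- by case=> k <-; rewrite !comp_assoc ef.
- by move=> e; case: (u S x e) => k [ek _]; exists k.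
Qed.

Lemma pullback_exists A B X (f : Hom A X) (g : Hom B X) :
  exists P (p : Hom P A) (q : Hom P B), is_pullback f g p q.
Proof.
pose m := equ_map (f ∘ pr1) (g ∘ @pr2 _ A B).
exists (equ (f ∘ pr1) (g ∘ pr2)), (pr1 ∘ m), (pr2 ∘ m); split.
  by rewrite !comp_assoc; have [-> _] := equ_is_equalizer (f ∘ pr1) (g ∘ @pr2 _ A B).
move=> Z a b e; have /in_equ [h mh] : f ∘ pr1 ∘ ⟨a, b⟩ = g ∘ pr2 ∘ ⟨a, b⟩ by cat.
exists h; split; first by rewrite !comp_assocr [equ_map _ _ ∘ h]mh; cat.
move=> h' [ea eb]; apply: (@equ_monic _ _ (f ∘ pr1) (g ∘ pr2)).
by rewrite mh -ea -eb; cat.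
Qed.

Lemma prod_map_monic A B C D (f : Hom A B) (g : Hom C D) :
  monic f -> monic g -> monic (prod_map f g).
Proof.
by move=> mf mg Z x y; cat=> /pair_inj [/mf e1 /mg e2]; apply: pair_ext.
Qed.

Lemma prod_map_pullback A B C D (f : Hom A B) (g : Hom C D) : monic f -> monic g ->
  is_pullback (prod_map (idm B) g) (prod_map f (idm D))
              (prod_map f (idm C)) (prod_map (idm A) g).
Proof.
move=> mf mg; split; first by cat.
move=> Z a b; cat=> /pair_inj [e1 e2]; exists ⟨pr1 ∘ b, pr2 ∘ a⟩; split.
  by split; apply: pair_ext; cat; rewrite ?e1 ?e2.
by move=> h [<- <-]; apply: pair_ext; cat.
Qed.

Lemma curry Z A B (f : Hom (Z × A) B) :
  exists h : Hom Z (exp A B), forall S (z : Hom S Z) (a : Hom S A),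
    ev A B ∘ ⟨h ∘ z, a⟩ = f ∘ ⟨z, a⟩.
Proof. by case: (exp_universal f) => h [<- _]; exists h => S z a; cat. Qed.

Lemma exp_ext Z A B (h k : Hom Z (exp A B)) :
  (forall S (z : Hom S Z) (a : Hom S A), ev A B ∘ ⟨h ∘ z, a⟩ = ev A B ∘ ⟨k ∘ z, a⟩) ->
  h = k.
Proof.
move=> e; case: (exp_universal (ev A B ∘ ⟨h ∘ pr1, pr2⟩)) => l [_ u].
by rewrite -(u h) // (u k).
Qed.

Definition extends T A W Z (j : Hom A W) (a : Hom (T × A) Z) (l : Hom (T × W) Z) : Prop :=
  forall S (t : Hom S T) (x : Hom S A), l ∘ ⟨t, j ∘ x⟩ = a ∘ ⟨t, x⟩.

Lemma extends_trans T A B W Z (j : Hom A B) (k : Hom B W) (a : Hom (T × A) Z)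
    (b : Hom (T × B) Z) (l : Hom (T × W) Z) :
  extends j a b -> extends k b l -> extends (k ∘ j) a l.
Proof. by move=> ab bl S t x; rewrite comp_assocr bl ab. Qed.

Lemma terminal_is_classifier (M : MorClass E) T0 T1 (t : Hom T0 T1) :
  (forall A B (u : Hom A B), M A B u -> monic u) ->
  (forall P A B X (f : Hom A X) (u : Hom B X) (p : Hom P A) (q : Hom P B),
     is_pullback f u p q -> M B X u -> M P A p) ->
  M T0 T1 t ->
  (forall A B (u : Hom A B), M A B u ->
     exists! ab : Hom A T0 * Hom B T1, is_pullback (snd ab) t u (fst ab)) ->
  is_classifier M t.
Proof.
move=> Mmonic Mpb Mt terminal; have mt := Mmonic _ _ _ Mt; split=> //.
- move=> A X m /terminal [[e c] [/= pb _]]; exists c; exact: pullback_classifies pb.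
- move=> X c; have [A [m [e pb]]] := pullback_exists c t; exists A, m.
  by split; [apply: Mpb pb Mt | apply: pullback_classifies pb].
- move=> X c c' cc'; have [A [m [e pb]]] := pullback_exists c t.
  have Mm := Mpb _ _ _ _ _ _ _ _ pb Mt.
  have [|e' pb'] := @classifies_pullback _ _ _ _ _ t c' m mt (Mmonic _ _ _ Mm).
    by move=> S x; rewrite -cc'; apply: pullback_classifies pb _ _.
  have [[a b] [_ u]] := terminal _ _ _ Mm.
  by case: (u (e, c) pb) => _ <-; case: (u (e', c') pb').
Qed.

Lemma dominance_classifier (C : MorClass E) : is_dominance C ->
  exists T0 T1 (t : Hom T0 T1), is_classifier C t.
Proof.
move=> dC; have [T0 [T1 [t [ct terminal]]]] := dom_terminal dC; exists T0, T1, t.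
apply: terminal_is_classifier => //; first exact: dom_monic dC.
exact: dom_pullback dC.
Qed.

Lemma truth_classifier : is_classifier (@monic E) (truth E).
Proof.
apply: terminal_is_classifier => //.
- by move=> P A B X f u p q; apply: monic_pullback.
- by move=> Z f g _; apply: one_ext.
- move=> A B u /classify [chi [pb uniq]]; exists (bang A, chi); split=> //.
  move=> [a c] /= pb'; rewrite (bang_unique a) (uniq c) //.
  by rewrite -(bang_unique a).
Qed.

Lemma dominance_idm (C : MorClass E) X : is_dominance C -> C X X (idm X).
Proof. by move=> dC; apply: (dom_iso dC); exists (idm X); rewrite comp_idl. Qed.

End LimitsAndExponentials.

Section InternalLogic.
Variable E : Topos.
Implicit Types A B S T W X Y Z : E.

Definition predicate X : Type := forall S, Hom S X -> Prop.

Definition representable X (phi : predicate X) : Prop :=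
  exists chi : Hom X (Omega E), forall S (x : Hom S X), chi ∘ x ∈ truth E <-> phi S x.

Definition natural X Y (a : forall S, Hom S X -> Hom S Y) : Prop :=
  forall S S' (x : Hom S X) (g : Hom S' S), a S' (x ∘ g) = a S x ∘ g.

Lemma in_truth S (q : Hom S (Omega E)) : q ∈ truth E <-> q = truth E ∘ bang S.
Proof.
split; last by move=> ->; exists (bang S).
by case=> s <-; rewrite (bang_unique s).
Qed.

Lemma representable_ext X (phi psi : predicate X) :
  representable phi -> (forall S x, phi S x <-> psi S x) -> representable psi.
Proof. by move=> [chi chiP] e; exists chi => S x; rewrite chiP e. Qed.

Lemma representable_comprehension X (phi : predicate X) : representable phi ->
  exists W (w : Hom W X), monic w /\ forall S (x : Hom S X), x ∈ w <-> phi S x.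
Proof.
move=> [chi chiP].
have [W [w [mw cw]]] := classifier_comprehension (truth_classifier E) chi.
by exists W, w; split=> // S x; rewrite -cw chiP.
Qed.

Lemma representable_in X A Y (m : Hom A Y) (a : forall S, Hom S X -> Hom S Y) :
  monic m -> natural a -> representable (fun S x => a S x ∈ m).
Proof.
move=> mm na; have [chi chiP] := classifier_char (truth_classifier E) mm.
by exists (chi ∘ a X (idm X)) => S x; rewrite comp_assocr -na comp_idl.
Qed.

Lemma representable_eq X Y (a b : forall S, Hom S X -> Hom S Y) :
  natural a -> natural b -> representable (fun S x => a S x = b S x).
Proof.
move=> na nb.
have := representable_in (@equ_monic _ _ _ (a X (idm X)) (b X (idm X)))
  (a := fun S x => x) (fun _ _ _ _ => eq_refl).
move/representable_ext; apply=> S x.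
by rewrite in_equ -na -nb comp_idl.
Qed.

Lemma representable_and X (phi psi : predicate X) :
  representable phi -> representable psi ->
  representable (fun S x => phi S x /\ psi S x).
Proof.
move=> [c cP] [d dP].
have := @representable_eq X _ (fun S x => ⟨c ∘ x, d ∘ x⟩)
  (fun S _ => ⟨truth E ∘ bang S, truth E ∘ bang S⟩).
move/(_ _ _)/representable_ext; apply; try naturality.
move=> S x; rewrite -cP -dP !in_truth.
by split=> [/pair_inj | [-> ->]].
Qed.

Lemma representable_imp X (phi psi : predicate X) :
  representable phi -> representable psi ->
  representable (fun S x => forall S' (g : Hom S' S), phi S' (x ∘ g) -> psi S' (x ∘ g)).
Proof.
move=> rphi rpsi; have [cd cdP] := representable_and rphi rpsi; case: rphi => c cP.
have := @representable_eq X _ (fun S x => c ∘ x) (fun S x => cd ∘ x).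
move/(_ _ _)/representable_ext; apply; try naturality.
move=> S x; split.
- move=> e S' g /cP; rewrite comp_assoc e comp_assocr; by case/cdP.
- move=> imp; apply: (classifier_ext (truth_classifier E)) => S' g.
  rewrite !comp_assocr cP cdP; split; last by case.
  by move=> px; split=> //; apply: imp.
Qed.

Lemma representable_all X T (phi : forall S, Hom S X -> Hom S T -> Prop) :
  representable (fun S (z : Hom S (X × T)) => phi S (pr1 ∘ z) (pr2 ∘ z)) ->
  representable (fun S (x : Hom S X) =>
    forall S' (g : Hom S' S) (t : Hom S' T), phi S' (x ∘ g) t).
Proof.
move=> [c cP]; have [h hE] := curry c; have [k kE] := curry (truth E ∘ bang (X × T)).
have := @representable_eq X _ (fun S x => h ∘ x) (fun S x => k ∘ x).
move/(_ _ _)/representable_ext; apply; try naturality.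
have cE S (x : Hom S X) (t : Hom S T) : phi S x t <-> c ∘ ⟨x, t⟩ = truth E ∘ bang S.
  by rewrite -in_truth cP pr1_pair pr2_pair.
move=> S x; split.
- by move=> e S' g t; apply/cE; rewrite -hE comp_assoc e comp_assocr kE; cat.
- move=> all; apply: exp_ext => S' g t; rewrite !comp_assocr hE kE; cat.
  exact/cE/all.
Qed.

Lemma representable_all_imp X T (phi psi : forall S, Hom S X -> Hom S T -> Prop) :
  representable (fun S (z : Hom S (X × T)) => phi S (pr1 ∘ z) (pr2 ∘ z)) ->
  representable (fun S (z : Hom S (X × T)) => psi S (pr1 ∘ z) (pr2 ∘ z)) ->
  representable (fun S (x : Hom S X) =>
    forall S' (g : Hom S' S) (t : Hom S' T), phi S' (x ∘ g) t -> psi S' (x ∘ g) t).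
Proof.
move=> rphi rpsi.
have := @representable_all X T (fun S x t =>
  forall S' (g : Hom S' S), phi S' (x ∘ g) (t ∘ g) -> psi S' (x ∘ g) (t ∘ g)).
move/(_ _)/representable_ext; apply.
- move/representable_ext: (representable_imp rphi rpsi); apply=> S z.
  by split=> imp S' g; move: (imp S' g); cat.
- move=> S x; split=> imp S' g t; first by move: (imp S' g t S' (idm S')); cat.
  by move=> S'' g' /=; rewrite !comp_assocr; apply: imp.
Qed.

Lemma coproduct_ind A B X (i : Hom A X) (j : Hom B X) (phi : predicate X) :
  is_coproduct i j -> representable phi -> phi A i -> phi B j ->
  forall S (x : Hom S X), phi S x.
Proof.
move=> ij [chi chiP] /chiP/in_truth ei /chiP/in_truth ej S x; apply/chiP.
have -> : chi = truth E ∘ bang X.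
  by apply: (coproduct_ext ij); rewrite ?ei ?ej; cat.
by apply/in_truth; cat.
Qed.

Lemma coproduct_inj_classifies T0 T1 (t : Hom T0 T1) A B S (i : Hom A S) (j : Hom B S)
    (c : Hom S T1) :
  monic t -> is_coproduct i j -> monic i -> c ∘ i ∈ t ->
  (forall S' (b : Hom S' B), c ∘ j ∘ b ∈ t -> is_initial S') -> classifies t c i.
Proof.
move=> mt ij mi ci cj T x; split; last first.
  by case=> a <-; rewrite comp_assoc; apply: sub_le_comp.
pose phi : predicate S := fun T x => forall T' (g : Hom T' T), c ∘ (x ∘ g) ∈ t -> x ∘ g ∈ i.
have rphi : representable phi.
  apply: (@representable_imp _ (fun S x => c ∘ x ∈ t) (fun S x => x ∈ i));
    apply: representable_in => //; naturality.
suff : phi T x by move/(_ T (idm T)); cat; apply.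
apply: (coproduct_ind ij rphi); first by move=> T' g _; exists g.
move=> T' g; rewrite comp_assoc => /cj iT'; have [a _] := iT' A.
by exists a; apply: initial_ext.
Qed.

Definition is_union_via X A B W (m : Hom A X) (n : Hom B X) (w : Hom W X)
    (j : Hom A W) (k : Hom B W) : Prop :=
  [/\ is_union m n w, w ∘ j = m & w ∘ k = n].

Lemma union_ind X A B W (m : Hom A X) (n : Hom B X) (w : Hom W X)
    (j : Hom A W) (k : Hom B W) (phi : predicate W) :
  is_union_via m n w j k ->
  representable phi -> phi A j -> phi B k -> forall S (x : Hom S W), phi S x.
Proof.
move=> [[mw [_ [_ least]]] wj wk] rphi pj pk S x.
have [V [v [mv vP]]] := representable_comprehension rphi.
have [| | l wvl] := least V (w ∘ v) (monic_comp mv mw).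
- by have /vP [a va] := pj; exists a; rewrite comp_assocr va.
- by have /vP [b vb] := pk; exists b; rewrite comp_assocr vb.
- by apply/vP; exists (l ∘ x); apply: mw; rewrite !comp_assoc wvl.
Qed.

Lemma union_prod_ext T X A B W Z (m : Hom A X) (n : Hom B X) (w : Hom W X)
    (j : Hom A W) (k : Hom B W) (f g : Hom (T × W) Z) :
  is_union_via m n w j k ->
  (forall S (t : Hom S T) (a : Hom S A), f ∘ ⟨t, j ∘ a⟩ = g ∘ ⟨t, j ∘ a⟩) ->
  (forall S (t : Hom S T) (b : Hom S B), f ∘ ⟨t, k ∘ b⟩ = g ∘ ⟨t, k ∘ b⟩) ->
  f = g.
Proof.
move=> uw ej ek; apply: prod_hom_ext => S t c.
have rfg : representable (fun S (c : Hom S W) =>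
    forall S' (h : Hom S' S) (t : Hom S' T), f ∘ ⟨t, c ∘ h⟩ = g ∘ ⟨t, c ∘ h⟩).
  apply: (@representable_all W T (fun S c t => f ∘ ⟨t, c⟩ = g ∘ ⟨t, c⟩)).
  by apply: representable_eq; naturality.
rewrite -[c]comp_idr.
by apply: (union_ind uw rfg) => S' h t'; [apply: ej | apply: ek].
Qed.

Lemma union_ext X A B W Z (m : Hom A X) (n : Hom B X) (w : Hom W X)
    (j : Hom A W) (k : Hom B W) (f g : Hom W Z) :
  is_union_via m n w j k ->
  f ∘ j = g ∘ j -> f ∘ k = g ∘ k -> f = g.
Proof.
move=> uw ej ek; apply: hom_ext.
by apply: (union_ind uw) => //; apply: representable_eq; naturality.
Qed.

Lemma union_agree T X A B D W Z (m : Hom A X) (n : Hom B X) (w : Hom W X)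
    (j : Hom A W) (k : Hom B W) (v : Hom D X) (l : Hom (T × W) Z) (d : Hom (T × D) Z) :
  is_union_via m n w j k ->
  (forall S (t : Hom S T) (x : Hom S A) (y : Hom S D),
     m ∘ x = v ∘ y -> l ∘ ⟨t, j ∘ x⟩ = d ∘ ⟨t, y⟩) ->
  (forall S (t : Hom S T) (x : Hom S B) (y : Hom S D),
     n ∘ x = v ∘ y -> l ∘ ⟨t, k ∘ x⟩ = d ∘ ⟨t, y⟩) ->
  forall S (t : Hom S T) (c : Hom S W) (y : Hom S D),
    w ∘ c = v ∘ y -> l ∘ ⟨t, c⟩ = d ∘ ⟨t, y⟩.
Proof.
move=> uw ej ek; have [_ wj wk] := uw.
pose phi : predicate W := fun S c => forall S' (g : Hom S' S) (z : Hom S' (T × D)),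
  w ∘ (c ∘ g) = v ∘ (pr2 ∘ z) -> l ∘ ⟨pr1 ∘ z, c ∘ g⟩ = d ∘ z.
have rphi : representable phi.
  apply: (@representable_all_imp W (T × D) (fun S c z => w ∘ c = v ∘ (pr2 ∘ z))
    (fun S c z => l ∘ ⟨pr1 ∘ z, c⟩ = d ∘ z)); apply: representable_eq; naturality.
move=> S t c y; suff : phi S c by move/(_ S (idm S) ⟨t, y⟩); cat.
apply: (union_ind uw rphi) => S' g z.
- by rewrite comp_assoc wj => /(ej _ (pr1 ∘ z)); cat.
- by rewrite comp_assoc wk => /(ek _ (pr1 ∘ z)); cat.
Qed.

(* Impredicatively, [x] lies in the union when every truth value [q] that is
   implied by both [x ∈ m] and [x ∈ n] holds. *)
Lemma union_exists X A B (m : Hom A X) (n : Hom B X) : monic m -> monic n ->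
  exists W (w : Hom W X) (j : Hom A W) (k : Hom B W), is_union_via m n w j k.
Proof.
move=> mm mn.
pose implied S (x : Hom S X) (q : Hom S (Omega E)) : Prop :=
  (forall S' (g : Hom S' S), x ∘ g ∈ m -> q ∘ g ∈ truth E) /\
  (forall S' (g : Hom S' S), x ∘ g ∈ n -> q ∘ g ∈ truth E).
have rin : representable (fun S (z : Hom S (X × Omega E)) => pr2 ∘ z ∈ truth E).
  by apply: representable_in (classifier_monic (truth_classifier E)) _; naturality.
have rimp D (l : Hom D X) : monic l -> representable (fun S (z : Hom S (X × Omega E)) =>
    forall S' (g : Hom S' S), pr1 ∘ z ∘ g ∈ l -> pr2 ∘ z ∘ g ∈ truth E).
  move=> ml; have rl : representable (fun S (z : Hom S (X × Omega E)) => pr1 ∘ z ∈ l).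
    by apply: representable_in ml _; naturality.
  move/representable_ext: (representable_imp rl rin); apply=> S z.
  by split=> imp S' g; move: (imp S' g); cat.
have := @representable_all_imp X (Omega E) implied (fun S _ q => q ∈ truth E).
case/(_ (representable_and (rimp _ _ mm) (rimp _ _ mn)) rin)/representable_comprehension.
move=> W [w [mw wP]].
have [j wj] : m ∈ w.
  by apply/wP => S g q [/(_ S (idm S)) qm _]; move: qm; cat; apply; exists g.
have [k wk] : n ∈ w.
  by apply/wP => S g q [_ /(_ S (idm S)) qn]; move: qn; cat; apply; exists g.
exists W, w, j, k; split=> //; split=> //; split; first by exists j.
split; first by exists k.
move=> V v mv m_le_v n_le_v.
have [chi chiP] := classifier_char (truth_classifier E) mv; apply/chiP.
have /wP/(_ W (idm W) (chi ∘ w)) : w ∈ w by exists (idm W); cat.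
by apply; split=> S g; cat=> g_in; apply/chiP; apply: sub_le_trans g_in _.
Qed.

Definition power X : E := exp X (Omega E).

Definition mem S X (x : Hom S X) (s : Hom S (power X)) : Prop :=
  ev X (Omega E) ∘ ⟨s, x⟩ ∈ truth E.

Lemma mem_representable T X (x : forall S, Hom S T -> Hom S X)
    (s : forall S, Hom S T -> Hom S (power X)) :
  natural x -> natural s -> representable (fun S z => mem (x S z) (s S z)).
Proof.
move=> nx ns; apply: representable_in (classifier_monic (truth_classifier E)) _.
by move=> S S' z g; rewrite nx ns; cat.
Qed.

Lemma power_ext B X (s s' : Hom B (power X)) :
  (forall S (b : Hom S B) (x : Hom S X), mem x (s ∘ b) <-> mem x (s' ∘ b)) -> s = s'.
Proof.
move=> e; apply: exp_ext => S b x.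
apply: (classifier_ext (truth_classifier E)) => S' g.
by move: (e S' (b ∘ g) (x ∘ g)); rewrite /mem; cat.
Qed.

Lemma power_comprehension B X (phi : forall S, Hom S B -> Hom S X -> Prop) :
  representable (fun S (z : Hom S (B × X)) => phi S (pr1 ∘ z) (pr2 ∘ z)) ->
  exists s : Hom B (power X),
    forall S (b : Hom S B) (x : Hom S X), mem x (s ∘ b) <-> phi S b x.
Proof.
move=> [chi chiP]; have [s sE] := curry chi; exists s => S b x.
by rewrite /mem sE chiP pr1_pair pr2_pair.
Qed.

Definition is_singleton X (sg : Hom X (power X)) : Prop :=
  forall S (x y : Hom S X), mem y (sg ∘ x) <-> x = y.

Lemma singleton_exists X : exists sg : Hom X (power X), is_singleton sg.
Proof.
apply: (@power_comprehension X X (fun S x y => x = y)).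
by apply: representable_eq; naturality.
Qed.

Lemma singleton_monic X (sg : Hom X (power X)) : is_singleton sg -> monic sg.
Proof. by move=> sgP S x y e; apply/sgP; rewrite e; apply/sgP. Qed.

(* The glued map sends [c] to the unique [z] that is [a s] whenever [w c = m s] and
   [b s] whenever [w c = n s]. *)
Lemma union_glue X A B W Z (m : Hom A X) (n : Hom B X) (w : Hom W X)
    (j : Hom A W) (k : Hom B W) (a : Hom A Z) (b : Hom B Z) :
  monic m -> monic n -> is_union_via m n w j k ->
  (forall S (s : Hom S A) (t : Hom S B), m ∘ s = n ∘ t -> a ∘ s = b ∘ t) ->
  exists h : Hom W Z, h ∘ j = a /\ h ∘ k = b.
Proof.
move=> mm mn uw agree; have [_ wj wk] := uw.
have [sg sgP] := singleton_exists Z; have msg := singleton_monic sgP.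
pose agrees D (l : Hom D X) (d : Hom D Z) S (c : Hom S W) (z : Hom S Z) : Prop :=
  forall S' (g : Hom S' S) (s : Hom S' D), w ∘ (c ∘ g) = l ∘ s -> z ∘ g = d ∘ s.
have ragrees D (l : Hom D X) (d : Hom D Z) :
    representable (fun S (y : Hom S (W × Z)) => agrees D l d S (pr1 ∘ y) (pr2 ∘ y)).
  have := @representable_all_imp (W × Z) D (fun S y s => w ∘ (pr1 ∘ y) = l ∘ s)
    (fun S y s => pr2 ∘ y = d ∘ s).
  move/(_ _ _)/representable_ext; apply; try by apply: representable_eq; naturality.
  by move=> S y; split=> imp S' g s; move: (imp S' g s); cat.
have [c cP] := @power_comprehension W Z (fun S x z => agrees A m a S x z /\ agrees B n b S x z)
  (representable_and (ragrees _ m a) (ragrees _ n b)).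
have agrees_eq D l d i S (s : Hom S D) z : w ∘ i = l -> agrees D l d S (i ∘ s) z -> z = d ∘ s.
  by move=> wi /(_ S (idm S) s); cat; apply; rewrite comp_assoc wi.
have agrees_refl D l d i S (s : Hom S D) :
    monic l -> w ∘ i = l -> agrees D l d S (i ∘ s) (d ∘ s).
  by move=> ml wi S' g t; cat; rewrite (comp_assoc w) wi => /ml ->.
have cj : c ∘ j = sg ∘ a.
  apply: power_ext => S s z; rewrite !comp_assocr cP sgP.
  split=> [[/(agrees_eq _ _ _ _ _ _ _ wj)] | <-] //; split; first exact: agrees_refl.
  by move=> S' g t; cat; rewrite (comp_assoc w) wj; apply: agree.
have ck : c ∘ k = sg ∘ b.
  apply: power_ext => S s z; rewrite !comp_assocr cP sgP.
  split=> [[_ /(agrees_eq _ _ _ _ _ _ _ wk)] | <-] //; split; last exact: agrees_refl.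
  by move=> S' g t; cat; rewrite (comp_assoc w) wk => e; symmetry; apply: agree.
have [h hE] : c ∈ sg.
  rewrite -[c]comp_idr; apply: (union_ind (phi := fun S x => c ∘ x ∈ sg) uw);
    [by apply: representable_in msg _; naturality | by exists a | by exists b].
exists h; split; apply: msg; by rewrite comp_assoc hE.
Qed.

Lemma union_pushout X A B P W (m : Hom A X) (n : Hom B X) (p : Hom P A) (q : Hom P B)
    (w : Hom W X) (j : Hom A W) (k : Hom B W) :
  monic m -> monic n -> is_pullback m n p q -> is_union_via m n w j k -> is_pushout p q j k.
Proof.
move=> mm mn [epq pb] uw; split.
  by have [[mw _] wj wk] := uw; apply: mw; rewrite !comp_assoc wj wk.
move=> Z a b eab; have [|h [hj hk]] := union_glue (a := a) (b := b) mm mn uw.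
  by move=> S s t /pb [l [[<- <-] _]]; rewrite !comp_assoc eab.
exists h; split=> // h' [hj' hk'].
by apply: (union_ext uw); rewrite ?hj ?hj' ?hk ?hk'.
Qed.

Lemma leibniz_product_exists A B C D (f : Hom A B) (g : Hom C D) :
  monic f -> monic g -> exists P (w : Hom P (B × D)), is_leibniz_product f g w.
Proof.
move=> mf mg.
have m1 : monic (prod_map (idm B) g) by apply: prod_map_monic => //; apply: idm_monic.
have m2 : monic (prod_map f (idm D)) by apply: prod_map_monic => //; apply: idm_monic.
have [W [w [j [k uw]]]] := union_exists m1 m2; have [_ wj wk] := uw.
exists W, w, j, k; split=> //.
exact: union_pushout m1 m2 (prod_map_pullback mf mg) uw.
Qed.

End InternalLogic.

Section IntervalPoints.
Variables (E : Topos) (I : Interval E).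
Implicit Types B S T X Z : E.

Definition vertex (i : bool) S : Hom S I := endpoint I i ∘ bang S.

Lemma vertex_comp i S S' (g : Hom S' S) : vertex i S ∘ g = vertex i S'.
Proof. by rewrite /vertex; cat. Qed.

Lemma endpointE i S (s : Hom S one) : endpoint I i ∘ s = vertex i S.
Proof. by rewrite /vertex (bang_unique s). Qed.

Lemma at_endE i B : at_end I i B = ⟨vertex i B, idm B⟩.
Proof. by []. Qed.

Lemma int0E : int0 I = vertex false I.
Proof. by []. Qed.

Lemma int1E : int1 I = vertex true I.
Proof. by []. Qed.

Lemma meet_0r S (t : Hom S I) : meet I ∘ ⟨t, vertex false S⟩ = vertex false S.
Proof. by move/(f_equal (fun f => f ∘ t)): (meet_x0 I); rewrite int0E /vertex; cat. Qed.

Lemma meet_0l S (t : Hom S I) : meet I ∘ ⟨vertex false S, t⟩ = vertex false S.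
Proof. by move/(f_equal (fun f => f ∘ t)): (meet_0x I); rewrite int0E /vertex; cat. Qed.

Lemma meet_1r S (t : Hom S I) : meet I ∘ ⟨t, vertex true S⟩ = t.
Proof. by move/(f_equal (fun f => f ∘ t)): (meet_x1 I); rewrite int1E /vertex; cat. Qed.

Lemma join_0r S (t : Hom S I) : join I ∘ ⟨t, vertex false S⟩ = t.
Proof. by move/(f_equal (fun f => f ∘ t)): (join_x0 I); rewrite int0E /vertex; cat. Qed.

Lemma join_0l S (t : Hom S I) : join I ∘ ⟨vertex false S, t⟩ = t.
Proof. by move/(f_equal (fun f => f ∘ t)): (join_0x I); rewrite int0E /vertex; cat. Qed.

Lemma join_1r S (t : Hom S I) : join I ∘ ⟨t, vertex true S⟩ = vertex true S.
Proof. by move/(f_equal (fun f => f ∘ t)): (join_x1 I); rewrite int1E /vertex; cat. Qed.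

Lemma join_1l S (t : Hom S I) : join I ∘ ⟨vertex true S, t⟩ = vertex true S.
Proof. by move/(f_equal (fun f => f ∘ t)): (join_1x I); rewrite int1E /vertex; cat. Qed.

Lemma degenerate_hom_ext S T X (f g : Hom T X) :
  two_inl I ∘ bang S = two_inr I ∘ bang S -> Hom T S -> f = g.
Proof.
move=> e t; have [f' fE] := curry (f ∘ @pr2 _ one T).
have [g' gE] := curry (g ∘ @pr2 _ one T).
have [h [[hl hr] _]] := @two_is_coproduct _ I _ f' g'.
have [<- <-] : ev T X ∘ ⟨f' ∘ bang T, idm T⟩ = f /\ ev T X ∘ ⟨g' ∘ bang T, idm T⟩ = g.
  by rewrite fE gE; cat.
by rewrite -hl -hr !comp_assocr -(bang_comp t) 2!(comp_assoc _ (bang S)) e.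
Qed.

(* Over [S] all parallel maps are equal, hence [S × X -> S] is a monomorphism with the
   same characteristic map as the identity of [S]; so it has a section. *)
Lemma degenerate_initial S : two_inl I ∘ bang S = two_inr I ∘ bang S -> is_initial S.
Proof.
move=> e X; have ext T Z (t : Hom T S) (f g : Hom T Z) := degenerate_hom_ext f g e t.
have m1 : monic (@pr1 _ S X) by move=> Z f g _; apply: ext (pr1 ∘ f) _ _.
have [chi chiP] := classifier_char (truth_classifier E) m1.
have [g _] : idm S ∈ @pr1 _ S X.
  by apply/chiP/in_truth; apply: ext (idm S) _ _.
by exists (pr2 ∘ g); split=> // f _; apply: ext (idm S) _ _.
Qed.

Lemma vertex_disjoint S : vertex false S = vertex true S -> is_initial S.
Proof.
rewrite /vertex /endpoint !comp_assocr => /(bdry_monic (i := I)).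
exact: degenerate_initial.
Qed.

Lemma initial_strict S Z : is_initial Z -> Hom S Z -> is_initial S.
Proof.
move=> iZ f; apply: degenerate_initial; rewrite -(bang_comp f) !comp_assoc.
by congr comp; apply: initial_ext.
Qed.

Lemma initial_exists : exists Z : E, is_initial Z.
Proof.
exists (equ (two_inl I) (two_inr I)); apply: degenerate_initial.
by rewrite -(bang_unique (equ_map _ _)); apply/in_equ; exists (idm _); cat.
Qed.

End IntervalPoints.

#[local] Hint Rewrite vertex_comp endpointE at_endE meet_0r meet_0l meet_1r join_0r join_0l
  join_1r join_1l : cat.

Section Cofibrations.
Variables (E : Topos) (I : Interval E) (C : MorClass E) (hC : cofibration_class I C).
Implicit Types A B S T W X Y Z : E.

Let cof_monic A B (u : Hom A B) : C u -> monic u := dom_monic (cof_dominance hC) (u := u).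

Lemma cof_retract_closed : retract_closed C.
Proof.
move=> A B X Y f g fg cg; have [s [s' pb]] := retract_pullback (cof_monic cg) fg.
exact: (dom_pullback (cof_dominance hC) pb cg).
Qed.

Lemma cof_prod_map T A B (u : Hom A B) : C u -> C (prod_map (idm T) u).
Proof.
move=> cu; apply: (dom_pullback (cof_dominance hC) (f := pr2) (u := u) (q := pr2)) cu.
split; first by cat.
move=> Z a b e; exists ⟨pr1 ∘ a, b⟩; split.
  by split; [apply: pair_ext|]; cat.
by move=> h [<- <-]; apply: pair_ext; cat.
Qed.

(* The injection of [A] is classified by the map that is "true" on [A] and "false"
   on [B]. *)
Lemma cof_coproduct_inj A B S (i : Hom A S) (j : Hom B S) :
  is_coproduct i j -> monic i -> C i.
Proof.
move=> ij mi; have [T0 [T1 [t tC]]] := dominance_classifier (cof_dominance hC).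
have mt := classifier_monic tC; have [Z iZ] := initial_exists I.
have [zB _] := iZ B; have [false_B falseP] := classifier_char tC (cof_initial hC zB iZ).
have [true_A trueP] := classifier_char tC (dominance_idm A (cof_dominance hC)).
have [c [[ci cj] _]] := ij T1 true_A false_B.
have [||e pb] := classifies_pullback mt mi (coproduct_inj_classifies mt ij mi (c := c) _ _).
- by rewrite ci -[true_A]comp_idr; apply/trueP; exists (idm A); cat.
- by move=> S' b; rewrite cj => /falseP [z _]; apply: initial_strict iZ z.
- exact: (dom_pullback (cof_dominance hC) pb (classifier_mem tC)).
Qed.

Lemma cof_endpoint i : C (endpoint I i).
Proof.
apply: (dom_comp (cof_dominance hC)); last exact: cof_bdry hC.
have two_ij := @two_is_coproduct _ I.
case: i; [apply: cof_coproduct_inj (coproduct_sym two_ij) _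
         | apply: cof_coproduct_inj two_ij _]; move=> Z f g _; exact: one_ext.
Qed.

Lemma cof_at_end i B : C (at_end I i B).
Proof.
apply: (dom_pullback (cof_dominance hC) (f := pr1) (u := endpoint I i)
  (q := bang B)) (cof_endpoint i).
split; first by cat.
move=> Z a b e; exists (pr2 ∘ a); split; last by move=> h [<- _]; cat.
split; last exact: one_ext.
by apply: pair_ext; cat=> //; rewrite e endpointE.
Qed.

Lemma cof_glue X A B Z (m : Hom A X) (n : Hom B X) (a : Hom A Z) (b : Hom B Z) :
  C m -> C n ->
  (forall S (x : Hom S A) (y : Hom S B), m ∘ x = n ∘ y -> a ∘ x = b ∘ y) ->
  exists W (w : Hom W X) (j : Hom A W) (k : Hom B W) (l : Hom W Z),
  [/\ C w, is_union_via m n w j k, l ∘ j = a & l ∘ k = b].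
Proof.
move=> cm cn agree; have mm := cof_monic cm; have mn := cof_monic cn.
have [W [w [j [k uw]]]] := union_exists mm mn; have [is_uw _ _] := uw.
have [l [lj lk]] := union_glue mm mn uw agree.
by exists W, w, j, k, l; split=> //; apply: (cof_union hC cm cn is_uw).
Qed.

Lemma cof_prod_glue T X A B Z (m : Hom A X) (n : Hom B X)
    (a : Hom (T × A) Z) (b : Hom (T × B) Z) :
  C m -> C n ->
  (forall S (t : Hom S T) (x : Hom S A) (y : Hom S B),
     m ∘ x = n ∘ y -> a ∘ ⟨t, x⟩ = b ∘ ⟨t, y⟩) ->
  exists W (w : Hom W X) (j : Hom A W) (k : Hom B W) (l : Hom (T × W) Z),
  [/\ C w, is_union_via m n w j k, extends j a l & extends k b l].
Proof.
move=> cm cn agree.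
have [a' aE] := curry (a ∘ ⟨pr2, pr1⟩); have [b' bE] := curry (b ∘ ⟨pr2, pr1⟩).
have [|W [w [j [k [l [cw uw lj lk]]]]]] := cof_glue (a := a') (b := b') cm cn.
  move=> S x y e; apply: exp_ext => S' g t; rewrite !comp_assocr aE bE; cat.
  by apply: agree; rewrite !comp_assoc e.
exists W, w, j, k, (ev T Z ∘ ⟨l ∘ pr2, pr1⟩); split=> // S t x; cat.
- by rewrite comp_assoc lj aE; cat.
- by rewrite comp_assoc lk bE; cat.
Qed.

End Cofibrations.

Section HomotopyLifting.
Variables (E : Topos) (I : Interval E) (C : MorClass E) (hC : cofibration_class I C).
Implicit Types A B S T W X Y Z : E.

Definition is_homotopy_lift X Y (p : Hom X Y) (i : bool) Z (x : Hom Z X)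
    (k : Hom (I × Z) Y) (h : Hom (I × Z) X) : Prop :=
  (forall S (t : Hom S I) (z : Hom S Z), p ∘ (h ∘ ⟨t, z⟩) = k ∘ ⟨t, z⟩) /\
  (forall S (z : Hom S Z), h ∘ ⟨vertex I i S, z⟩ = x ∘ z).

Definition has_lift_extensions X Y (p : Hom X Y) : Prop :=
  forall i A Z (u : Hom A Z) (x : Hom Z X) (k : Hom (I × Z) Y) (h : Hom (I × A) X),
    C u -> p ∘ x = k ∘ at_end I i Z ->
    is_homotopy_lift p i (x ∘ u) (k ∘ prod_map (idm I) u) h ->
    exists d, is_homotopy_lift p i x k d /\ extends u h d.

Lemma fibration_lift_extensions X Y (p : Hom X Y) :
  fibration I C p -> has_lift_extensions p.
Proof.
move=> fp i A Z u x k h cu px [ph hx].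
have m0 : monic (endpoint I i) by move=> ? ? ? _; apply: one_ext.
have [P [w lw]] := leibniz_product_exists m0 (dom_monic (cof_dominance hC) cu).
have [j1 [j2 [po [wj1 wj2]]]] := lw; have [_ po_univ] := po.
have [|t [[tj1 tj2] _]] := po_univ X h (x ∘ pr2).
  by apply: prod_hom_ext => S s a; cat; rewrite hx; cat.
have pt : p ∘ t = k ∘ w.
  apply: (pushout_ext po); apply: prod_hom_ext => S s z; rewrite !comp_assocr.
    by rewrite (comp_assoc t) tj1 ph (comp_assoc w) wj1; cat.
  by rewrite (comp_assoc t) tj2 (comp_assoc w) wj2; cat; rewrite comp_assoc px; cat.
have [d [dw pd]] := fp i A Z u P w cu lw t k pt; exists d; split; first split.
- by move=> S t' z; rewrite comp_assoc pd.
- move=> S z; move/(f_equal (fun f => d ∘ f ∘ ⟨bang S, z⟩)): wj2.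
  by rewrite (comp_assoc d) dw tj2; cat.
- move=> S t' a; move/(f_equal (fun f => d ∘ f ∘ ⟨t', a⟩)): wj1.
  by rewrite (comp_assoc d) dw tj1; cat.
Qed.

Lemma lift_extensions_fibration X Y (p : Hom X Y) :
  has_lift_extensions p -> fibration I C p.
Proof.
move=> ext i A Z u P w cu [j1 [j2 [po [wj1 wj2]]]] t k e; have [ej _] := po.
have [||d [[pd dx] dh]] := ext i A Z u (t ∘ (j2 ∘ ⟨bang Z, idm Z⟩)) k (t ∘ j1) cu.
- by rewrite comp_assoc e comp_assocr (comp_assoc w) wj2; cat.
- split=> [S s a | S a].
    by rewrite !comp_assoc e (comp_assocr k) wj1.
  by move/(f_equal (fun f => t ∘ f ∘ ⟨bang S, a⟩)): ej; cat.
- exists d; split; last by apply: prod_hom_ext => S s z; rewrite comp_assocr pd.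
  apply: (pushout_ext po); apply: prod_hom_ext => S s z; rewrite !comp_assocr.
    by rewrite (comp_assoc w) wj1; cat; rewrite dh; cat.
  by rewrite (comp_assoc w) wj2; cat; rewrite dx (bang_unique s); cat.
Qed.

Lemma homotopy_lift_bang i X Z (x : Hom Z X) k (h : Hom (I × Z) X) :
  (forall S (z : Hom S Z), h ∘ ⟨vertex I i S, z⟩ = x ∘ z) ->
  is_homotopy_lift (bang X) i x k h.
Proof. by split=> // S t z; apply: one_ext. Qed.

Lemma initial_homotopy_lift X Y (p : Hom X Y) i Z (x : Hom Z X) (k : Hom (I × Z) Y) :
  is_initial Z -> exists h, is_homotopy_lift p i x k h.
Proof.
move=> iZ; have [h _] := initial_strict I iZ (@pr2 _ I Z) X.
by exists h; split=> S; [move=> t|]; move=> z; apply: initial_ext;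
  apply: initial_strict iZ z.
Qed.

Lemma fibration_homotopy_lift X Y (p : Hom X Y) i Z (x : Hom Z X) (k : Hom (I × Z) Y) :
  fibration I C p -> p ∘ x = k ∘ at_end I i Z -> exists d, is_homotopy_lift p i x k d.
Proof.
move=> /fibration_lift_extensions fp px; have [A iA] := initial_exists I; have [u _] := iA Z.
have [h hP] := initial_homotopy_lift p i (x ∘ u) (k ∘ prod_map (idm I) u) iA.
by have [d [dP _]] := fp i A Z u x k h (cof_initial hC u iA) px hP; exists d.
Qed.

Lemma homotopy_lift_glue X Y (p : Hom X Y) i A B Z (m : Hom A Z) (n : Hom B Z)
    (x : Hom Z X) (k : Hom (I × Z) Y) (a : Hom (I × A) X) (b : Hom (I × B) X) :
  C m -> C n ->
  is_homotopy_lift p i (x ∘ m) (k ∘ prod_map (idm I) m) a ->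
  is_homotopy_lift p i (x ∘ n) (k ∘ prod_map (idm I) n) b ->
  (forall S (t : Hom S I) (y : Hom S A) (z : Hom S B),
     m ∘ y = n ∘ z -> a ∘ ⟨t, y⟩ = b ∘ ⟨t, z⟩) ->
  exists W (w : Hom W Z) (j1 : Hom A W) (j2 : Hom B W) (l : Hom (I × W) X),
  [/\ C w, is_union_via m n w j1 j2,
      is_homotopy_lift p i (x ∘ w) (k ∘ prod_map (idm I) w) l,
      extends j1 a l & extends j2 b l].
Proof.
move=> cm cn [pa ax] [pb bx] agree.
have [W [w [j1 [j2 [l [cw uw la lb]]]]]] := cof_prod_glue hC cm cn agree.
have [_ wj1 wj2] := uw; exists W, w, j1, j2, l; split=> //; split.
- suff e : p ∘ l = k ∘ prod_map (idm I) w by move=> S t z; rewrite comp_assoc e.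
  apply: (union_prod_ext uw) => S t z; rewrite !comp_assocr.
  + by rewrite la pa; cat; rewrite (comp_assoc w) wj1.
  + by rewrite lb pb; cat; rewrite (comp_assoc w) wj2.
- suff e : l ∘ at_end I i W = x ∘ w.
    by move=> S z; rewrite -e; cat.
  apply: (union_ext uw); apply: hom_ext => S z; cat.
  + by rewrite la ax -wj1; cat.
  + by rewrite lb bx -wj2; cat.
Qed.

(* The box is [I × (I × B)] with one face of the first coordinate, both faces of the
   second one, and the part over [A]. *)
Lemma fibration_lift_boundary X Y (p : Hom X Y) i A B (u : Hom A B) (x : Hom (I × B) X)
    (k : Hom (I × (I × B)) Y) (s : bool -> Hom (I × B) X) (h : Hom (I × (I × A)) X) :
  fibration I C p -> C u -> p ∘ x = k ∘ at_end I i (I × B) ->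
  (forall e, is_homotopy_lift p i (x ∘ at_end I e B)
     (k ∘ prod_map (idm I) (at_end I e B)) (s e)) ->
  is_homotopy_lift p i (x ∘ prod_map (idm I) u)
    (k ∘ prod_map (idm I) (prod_map (idm I) u)) h ->
  (forall e S (t : Hom S I) (a : Hom S A),
     h ∘ ⟨t, ⟨vertex I e S, a⟩⟩ = s e ∘ ⟨t, u ∘ a⟩) ->
  exists d, [/\ is_homotopy_lift p i x k d, forall e, extends (at_end I e B) (s e) d &
    extends (prod_map (idm I) u) h d].
Proof.
move=> /fibration_lift_extensions fp cu px sP hP hs.
have [|W [w [j0 [j1 [l [cw uw lP l0 l1]]]]]] :=
  homotopy_lift_glue (cof_at_end hC false B) (cof_at_end hC true B) (sP false) (sP true).
  move=> S t y z; cat=> /pair_inj [/vertex_disjoint iS _].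
  exact: initial_ext.
have [_ wj0 wj1] := uw.
have agree e S (t : Hom S I) (y : Hom S B) (z : Hom S (I × A)) :
    at_end I e B ∘ y = prod_map (idm I) u ∘ z -> s e ∘ ⟨t, y⟩ = h ∘ ⟨t, z⟩.
  cat=> /pair_inj [ez ->]; rewrite -hs ez; by cat.
have [|V [v [k1 [k2 [g [cv uv gP gl gh]]]]]] :=
  homotopy_lift_glue cw (cof_prod_map hC I cu) lP hP.
  by apply: (union_agree uw) => S t y z e; rewrite ?l0 ?l1; apply: agree.
have [_ vk1 vk2] := uv.
have [d [dP dg]] := fp i V _ v x k g cv px gP.
exists d; split=> //; last by rewrite -vk2; apply: extends_trans gh dg.
have dl : extends w l d by rewrite -vk1; apply: extends_trans gl dg.
by case; [rewrite -wj1 | rewrite -wj0]; apply: extends_trans dl.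
Qed.

Lemma fibration_lift_ends X Y (p : Hom X Y) i B (x : Hom (I × B) X)
    (k : Hom (I × (I × B)) Y) (s : bool -> Hom (I × B) X) :
  fibration I C p -> p ∘ x = k ∘ at_end I i (I × B) ->
  (forall e, is_homotopy_lift p i (x ∘ at_end I e B)
     (k ∘ prod_map (idm I) (at_end I e B)) (s e)) ->
  exists d, is_homotopy_lift p i x k d /\ forall e, extends (at_end I e B) (s e) d.
Proof.
move=> fp px sP; have [A iA] := initial_exists I; have [u _] := iA B.
have iIA : is_initial (I × A) := initial_strict I iA pr2.
have [h hP] := initial_homotopy_lift p i (x ∘ prod_map (idm I) u)
  (k ∘ prod_map (idm I) (prod_map (idm I) u)) iIA.
have [|d [dP ds _]] := fibration_lift_boundary fp (cof_initial hC u iA) px sP hP.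
  by move=> e S t a; apply: initial_ext; apply: initial_strict iA a.
by exists d.
Qed.

End HomotopyLifting.

Section Homotopies.
Variables (E : Topos) (I : Interval E) (C : MorClass E) (hC : cofibration_class I C).
Implicit Types A B S T W X Y Z : E.

Definition is_homotopy B A (H : Hom (I × B) A) (f g : Hom B A) : Prop :=
  (forall S (b : Hom S B), H ∘ ⟨vertex I false S, b⟩ = f ∘ b) /\
  (forall S (b : Hom S B), H ∘ ⟨vertex I true S, b⟩ = g ∘ b).

Lemma homotopicP B A (f g : Hom B A) :
  homotopic I f g <-> exists H, is_homotopy H f g.
Proof.
split=> -[H].
- by move=> [<- <-]; exists H; split=> S b; cat.
- by move=> [H0 H1]; exists H; cat; rewrite H0 H1; cat.
Qed.

Lemma lid_homotopy j B A (d : Hom (I × (I × B)) A) (s : bool -> Hom (I × B) A)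
    (f g : Hom B A) :
  (forall e, extends (at_end I e B) (s e) d) ->
  (forall S (b : Hom S B), s false ∘ ⟨vertex I j S, b⟩ = f ∘ b) ->
  (forall S (b : Hom S B), s true ∘ ⟨vertex I j S, b⟩ = g ∘ b) ->
  is_homotopy (d ∘ at_end I j (I × B)) f g.
Proof.
move=> ds sf sg; split=> S b.
- by rewrite -sf; have := ds false S (vertex I j S) b; cat.
- by rewrite -sg; have := ds true S (vertex I j S) b; cat.
Qed.

Lemma homotopic_refl B A (f : Hom B A) : homotopic I f f.
Proof. by apply/homotopicP; exists (f ∘ pr2); split=> S b; cat. Qed.

Lemma homotopic_compl B A A' (f g : Hom B A) (h : Hom A A') :
  homotopic I f g -> homotopic I (h ∘ f) (h ∘ g).
Proof. by case=> H [<- <-]; exists (h ∘ H); rewrite !comp_assoc. Qed.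

Lemma homotopic_compr B B' A (f g : Hom B A) (h : Hom B' B) :
  homotopic I f g -> homotopic I (f ∘ h) (g ∘ h).
Proof. by case=> H [<- <-]; exists (H ∘ prod_map (idm I) h); cat. Qed.

Lemma homotopic_transfer B A (f f' g g' : Hom B A) : fibrant I C A ->
  homotopic I f f' -> homotopic I g g' -> homotopic I f g -> homotopic I f' g'.
Proof.
move=> fA /homotopicP [H [H0 H1]] /homotopicP [H' [H'0 H'1]] /homotopicP [K [K0 K1]].
have [||d [_ ds]] := fibration_lift_ends hC (i := false) (x := K) (k := bang _)
  (s := fun e : bool => if e then H' else H) fA; first exact: one_ext.
  by case; apply: homotopy_lift_bang => S b; cat; rewrite ?H0 ?H'0 ?K0 ?K1.
by apply/homotopicP; exists (d ∘ at_end I true (I × B)); apply: (lid_homotopy ds).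
Qed.

Lemma homotopic_sym B A (f g : Hom B A) : fibrant I C A ->
  homotopic I f g -> homotopic I g f.
Proof.
move=> fA fg.
exact: (homotopic_transfer fA fg (homotopic_refl f) (homotopic_refl f)).
Qed.

Lemma homotopic_trans B A (f g h : Hom B A) : fibrant I C A ->
  homotopic I f g -> homotopic I g h -> homotopic I f h.
Proof. by move=> fA fg gh; apply: (homotopic_transfer fA (homotopic_refl f) gh fg). Qed.

Lemma homotopy_equivalence_comp X Y Z (f : Hom X Y) (g : Hom Y Z) :
  fibrant I C X -> fibrant I C Z ->
  homotopy_equivalence I f -> homotopy_equivalence I g -> homotopy_equivalence I (g ∘ f).
Proof.
move=> fX fZ [f' [f'f ff']] [g' [g'g gg']]; exists (f' ∘ g'); split.
- apply: homotopic_trans fX _ f'f.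
  by have := homotopic_compl f' (homotopic_compr f g'g); rewrite comp_idl !comp_assoc.
- apply: homotopic_trans fZ _ gg'.
  by have := homotopic_compl g (homotopic_compr g' ff'); rewrite comp_idl !comp_assoc.
Qed.

Lemma homotopy_equivalence_cancelr X Y Z (f : Hom X Y) (g : Hom Y Z) : fibrant I C Y ->
  homotopy_equivalence I f -> homotopy_equivalence I (g ∘ f) -> homotopy_equivalence I g.
Proof.
move=> fY [f' [f'f ff']] [h [hgf gfh]]; exists (f ∘ h).
split; last by rewrite comp_assoc.
have fhg_ff' : homotopic I (f ∘ h ∘ g ∘ (f ∘ f')) (f ∘ h ∘ g).
  by have := homotopic_compl (f ∘ h ∘ g) ff'; rewrite comp_idr.
have ff'_fhg : homotopic I (f ∘ h ∘ g ∘ (f ∘ f')) (f ∘ f').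
  by have := homotopic_compl f (homotopic_compr f' hgf); rewrite comp_idl !comp_assoc.
exact: (homotopic_transfer fY fhg_ff' ff' ff'_fhg).
Qed.

Lemma homotopy_equivalence_cancell X Y Z (f : Hom X Y) (g : Hom Y Z) : fibrant I C Y ->
  homotopy_equivalence I g -> homotopy_equivalence I (g ∘ f) -> homotopy_equivalence I f.
Proof.
move=> fY [g' [g'g gg']] [h [hgf gfh]]; exists (h ∘ g).
split; first by rewrite comp_assocr.
have g'g_fhg : homotopic I (g' ∘ g ∘ (f ∘ (h ∘ g))) (f ∘ (h ∘ g)).
  by have := homotopic_compr (f ∘ (h ∘ g)) g'g; rewrite comp_idl.
have fhg_g'g : homotopic I (g' ∘ g ∘ (f ∘ (h ∘ g))) (g' ∘ g).
  by have := homotopic_compl g' (homotopic_compr g gfh); rewrite comp_idl !comp_assoc.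
exact: (homotopic_transfer fY g'g_fhg g'g fhg_g'g).
Qed.

Lemma homotopy_equivalence_retract_closed : retract_closed (homotopy_equivalence I).
Proof.
move=> A B X Y f g [s [r [s' [r' [rs [rs' [gs fr]]]]]]] [g' [g'g gg']].
exists (r ∘ g' ∘ s'); split.
- by have := homotopic_compl r (homotopic_compr s g'g); rewrite comp_idl rs !comp_assocr gs.
- have := homotopic_compl r' (homotopic_compr s' gg').
  by rewrite comp_idl rs' !comp_assoc -fr.
Qed.

End Homotopies.

Section Fibrations.
Variables (E : Topos) (I : Interval E) (C : MorClass E) (hC : cofibration_class I C).
Implicit Types A B S T W X Y Z : E.

Lemma fibration_retract_closed : retract_closed (fibration I C).
Proof.
move=> A B X Y f g fg pg i U V u P w cu lw.
exact: rlp_retract fg (pg i U V u P w cu lw).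
Qed.

Lemma fibration_comp X Y Z (p : Hom X Y) (q : Hom Y Z) :
  fibration I C p -> fibration I C q -> fibration I C (q ∘ p).
Proof. by move=> fp fq i A B u P w cu lw; apply: rlp_comp; [apply: fp lw | apply: fq lw]. Qed.

Lemma fibrant_total X Y (p : Hom X Y) : fibration I C p -> fibrant I C Y -> fibrant I C X.
Proof. by move=> fp fY; rewrite /fibrant -(bang_comp p); apply: fibration_comp. Qed.

Definition trivial_fibration : MorClass E := fun X Y p =>
  forall A B (u : Hom A B), C u -> rlp u p.

Lemma trivial_fibration_fibration X Y (p : Hom X Y) :
  trivial_fibration p -> fibration I C p.
Proof.
move=> tp; apply: (lift_extensions_fibration (I := I)) => i A Z u x k h cu px [ph hx].
have [|W [w [j1 [j2 [l [cw uw lh lx]]]]]] :=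
  cof_glue hC (a := h) (b := x) (cof_prod_map hC I cu) (cof_at_end hC i Z).
  move=> S y z; cat=> /pair_inj [y1 <-].
  by rewrite -(pair_pr_comp y) y1 hx; cat.
have [_ wj1 wj2] := uw.
have [|d [dw pd]] := tp _ _ w cw l k.
  apply: (union_ext uw).
    apply: prod_hom_ext => S t a.
    by rewrite (comp_assocr p) lh !comp_assocr ph (comp_assoc w) wj1; cat.
  by rewrite comp_assocr lx px -wj2 comp_assoc.
exists d; split; first split.
- by move=> S t z; rewrite comp_assoc pd.
- by move=> S z; rewrite -lx -dw !comp_assocr (comp_assoc w) wj2; cat.
- by move=> S t a; rewrite -lh -dw !comp_assocr (comp_assoc w) wj1; cat.
Qed.

Lemma trivial_fibration_homotopy_equivalence X Y (p : Hom X Y) :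
  trivial_fibration p -> homotopy_equivalence I p.
Proof.
move=> tp; have [Z iZ] := initial_exists I.
have [zX _] := iZ X; have [zY _] := iZ Y.
have [s [_ ps]] := tp _ _ zY (cof_initial hC zY iZ) zX (idm Y) (initial_ext _ _ iZ).
exists s; split; last by rewrite ps; apply: homotopic_refl.
have [|W [w [j0 [j1 [l [cw uw l0 l1]]]]]] :=
  cof_glue hC (a := s ∘ p) (b := idm X) (cof_at_end hC false X) (cof_at_end hC true X).
  move=> S y z; cat=> /pair_inj [/vertex_disjoint iS _]; exact: initial_ext.
have [_ wj0 wj1] := uw.
have [|d [dw _]] := tp _ _ w cw l (p ∘ pr2).
  apply: (union_ext uw); rewrite !comp_assocr ?l0 ?l1 ?wj0 ?wj1; cat=> //.
  by rewrite comp_assoc ps; cat.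
by exists d; rewrite -wj0 -wj1 -l0 -l1 -dw !comp_assocr.
Qed.

Definition is_vertical_deformation X Y (f : Hom X Y) (s : Hom Y X)
    (G : Hom (I × X) X) : Prop :=
  [/\ f ∘ s = idm Y, is_homotopy G (s ∘ f) (idm X) &
    forall S (t : Hom S I) (x : Hom S X), f ∘ (G ∘ ⟨t, x⟩) = f ∘ x].

Lemma fibration_homotopy_equivalence_section X Y (f : Hom X Y) :
  fibrant I C X -> fibration I C f -> homotopy_equivalence I f ->
  exists s, f ∘ s = idm Y /\ homotopic I (s ∘ f) (idm X).
Proof.
move=> fX ff [g [gf /homotopicP [H [H0 H1]]]].
have [|H' [fH' H'0]] := fibration_homotopy_lift hC (i := false) (x := g) (k := H) ff.
  by cat; rewrite H0; cat.
exists (H' ∘ at_end I true Y); split; first by cat; rewrite fH' H1; cat.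
apply: (homotopic_trans hC fX _ gf); apply: (homotopic_sym hC fX); apply: homotopic_compr.
by apply/homotopicP; exists H'; split=> S b; cat.
Qed.

(* The homotopy [K : s f ~ 1] is made vertical by filling the open box over
   [f (K (i \/ j, x))] with sides [s f K] and the identity. *)
Lemma fibration_vertical_deformation X Y (f : Hom X Y) (s : Hom Y X) :
  fibration I C f -> f ∘ s = idm Y -> homotopic I (s ∘ f) (idm X) ->
  exists G, is_vertical_deformation f s G.
Proof.
move=> ff fs /homotopicP [K [K0 K1]].
have fsK S (y : Hom S Y) : f ∘ (s ∘ y) = y by rewrite comp_assoc fs comp_idl.
have [||d [[fd _] ds]] := fibration_lift_ends hC (i := false) (x := K)
  (k := f ∘ K ∘ ⟨join I ∘ ⟨pr1 ∘ pr2, pr1⟩, pr2 ∘ pr2⟩)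
  (s := fun e : bool => if e then pr2 else s ∘ f ∘ K) ff; first by cat.
  by case; split=> S; [move=> t| |move=> t|]; move=> z; cat; rewrite ?K0 ?K1; cat;
    rewrite ?fsK.
exists (d ∘ at_end I true (I × X)); split=> //.
- by apply: (lid_homotopy ds) => S x; cat; rewrite ?K1; cat.
- by move=> S t x; cat; rewrite fd; cat; rewrite K1; cat.
Qed.

Lemma vertical_deformation_trivial_fibration X Y (f : Hom X Y) s G :
  fibration I C f -> is_vertical_deformation f s G -> trivial_fibration f.
Proof.
move=> /(fibration_lift_extensions hC) ff [fs [G0 G1] fG] A B u cu t b e.
have [||D [[fD _] Du]] := ff false A B u (s ∘ b) (b ∘ pr2) (G ∘ ⟨pr1, t ∘ pr2⟩) cu.
- by rewrite comp_assoc fs; cat.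
- split=> [S r a | S a]; cat; first by rewrite fG !comp_assoc e.
  by rewrite G0 !comp_assocr !(comp_assoc f) e; cat.
- exists (D ∘ at_end I true B); split; last by apply: hom_ext => S y; cat; rewrite fD; cat.
  by apply: hom_ext => S a; cat; rewrite Du; cat; rewrite G1; cat.
Qed.

Lemma fibration_homotopy_equivalence_trivial X Y (f : Hom X Y) :
  fibrant I C X -> fibration I C f -> homotopy_equivalence I f -> trivial_fibration f.
Proof.
move=> fX ff /(fibration_homotopy_equivalence_section fX ff) [s [fs sf]].
have [G] := fibration_vertical_deformation ff fs sf.
exact: vertical_deformation_trivial_fibration.
Qed.

Definition is_strong_deformation A B (u : Hom A B) (r : Hom B A)
    (G : Hom (I × B) B) : Prop :=
  [/\ r ∘ u = idm A, is_homotopy G (u ∘ r) (idm B) &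
    forall S (t : Hom S I) (a : Hom S A), G ∘ ⟨t, u ∘ a⟩ = u ∘ a].

Lemma cof_homotopy_equivalence_retraction A B (u : Hom A B) :
  fibrant I C A -> fibrant I C B -> C u -> homotopy_equivalence I u ->
  exists r, r ∘ u = idm A /\ homotopic I (u ∘ r) (idm B).
Proof.
move=> fA fB cu [g [/homotopicP [H [H0 H1]] ug]].
have [||H' [[_ H'0] H'u]] := fibration_lift_extensions hC fA (i := false) (x := g)
  (k := bang _) (h := H) cu; first exact: one_ext.
  exact: homotopy_lift_bang.
exists (H' ∘ at_end I true B); split.
  by apply: hom_ext => S a; cat; rewrite H'u H1; cat.
apply: (homotopic_trans hC fB _ ug); apply: (homotopic_sym hC fB); apply: homotopic_compl.
by apply/homotopicP; exists H'; split=> S b; cat.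
Qed.

(* Dually, the homotopy [K : u r ~ 1] is made constant on [A] by filling the open box
   with sides [K u r] and the identity, and [K (i \/ j, u a)] over [A]. *)
Lemma cof_strong_deformation A B (u : Hom A B) (r : Hom B A) :
  fibrant I C B -> C u -> r ∘ u = idm A -> homotopic I (u ∘ r) (idm B) ->
  exists G, is_strong_deformation u r G.
Proof.
move=> fB cu ru /homotopicP [K [K0 K1]].
have ruK S (a : Hom S A) : r ∘ (u ∘ a) = a by rewrite comp_assoc ru comp_idl.
have [||||d [_ ds dh]] := fibration_lift_boundary hC (i := false) (x := K) (k := bang _)
  (s := fun e : bool => if e then pr2 else K ∘ ⟨pr1, u ∘ (r ∘ pr2)⟩)
  (h := K ∘ ⟨join I ∘ ⟨pr1 ∘ pr2, pr1⟩, u ∘ (pr2 ∘ pr2)⟩) fB cu.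
- exact: one_ext.
- by case; apply: homotopy_lift_bang => S b; cat; rewrite ?K0 ?K1; cat; rewrite ?ruK.
- by apply: homotopy_lift_bang => S a; cat.
- by case=> S t a; cat; rewrite ?K1 ?ruK; cat.
- exists (d ∘ at_end I true (I × B)); split=> //.
    by apply: (lid_homotopy ds) => S b; cat; rewrite ?K1; cat.
  move=> S t a; have := dh S (vertex I true S) ⟨t, a⟩; cat=> ->.
  by rewrite K1; cat.
Qed.

Lemma strong_deformation_rlp A B X Y (u : Hom A B) r G (p : Hom X Y) :
  C u -> is_strong_deformation u r G -> fibration I C p -> rlp u p.
Proof.
move=> cu [ru [G0 G1] Gu] /(fibration_lift_extensions hC) fp t b e.
have [||D [[pD _] Du]] := fp false A B u (t ∘ r) (b ∘ G) (t ∘ pr2) cu.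
- by cat; rewrite G0 comp_idr !comp_assoc e.
- split=> [S i a | S a]; cat; first by rewrite Gu !comp_assoc e.
  by rewrite (comp_assoc r) ru; cat.
- exists (D ∘ at_end I true B); split; last by apply: hom_ext => S y; cat; rewrite pD; cat;
    rewrite G1; cat.
  by apply: hom_ext => S a; cat; rewrite Du; cat.
Qed.

Lemma cof_homotopy_equivalence_rlp A B X Y (u : Hom A B) (p : Hom X Y) :
  fibrant I C A -> fibrant I C B ->
  C u -> homotopy_equivalence I u -> fibration I C p -> rlp u p.
Proof.
move=> fA fB cu /(cof_homotopy_equivalence_retraction fA fB cu) [r [ru ur]].
have [G] := cof_strong_deformation fB cu ru ur.
exact: strong_deformation_rlp.
Qed.

End Fibrations.

Section PartialMaps.
Variables (E : Topos) (C : MorClass E).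
Implicit Types A B S T X Y Z : E.

Lemma is_pullback_graph A B P X (f : Hom A X) (g : Hom B X) (p : Hom P A) (q : Hom P B) :
  monic ⟨p, q⟩ ->
  is_pullback f g p q <->
  forall S (a : Hom S A) (b : Hom S B), f ∘ a = g ∘ b <-> ⟨a, b⟩ ∈ ⟨p, q⟩.
Proof.
move=> mpq; split=> [[e pb] S a b | graph].
- split=> [/pb [h [[<- <-] _]] | [h]]; first by exists h; rewrite pair_comp.
  by rewrite pair_comp => /pair_inj [<- <-]; rewrite !comp_assoc e.
- split; first by apply/graph; exists (idm P); rewrite comp_idr.
  move=> S a b /graph [h e]; exists h; split; first by apply: pair_inj; rewrite -pair_comp.
  by move=> h' [pa qb]; apply: mpq; rewrite e pair_comp pa qb.
Qed.

Definition is_partial_map_classifier X X' (eta : Hom X X') : Prop :=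
  C eta /\ forall A B (k : Hom A B) (x : Hom A X), C k ->
    exists! a : Hom B X', is_pullback a eta k x.

Section PartialElements.
Variables (T0 T1 : E) (t : Hom T0 T1) (tC : is_classifier C t).
Variables (X : E) (sg : Hom X (power X)) (sgP : is_singleton sg).

(* The subset [s] is a singleton where [c] holds and empty elsewhere. *)
Definition is_partial_element S (c : Hom S T1) (s : Hom S (power X)) : Prop :=
  (forall S' (g : Hom S' S) (x : Hom S' X), mem x (s ∘ g) -> c ∘ g ∈ t) /\
  (forall S' (g : Hom S' S), c ∘ g ∈ t -> s ∘ g ∈ sg).

Lemma partial_element_representable :
  representable (fun S (z : Hom S (T1 × power X)) =>
    is_partial_element (pr1 ∘ z) (pr2 ∘ z)).
Proof.
have ct Y (a : forall S, Hom S Y -> Hom S T1) : natural a ->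
    representable (fun S z => a S z ∈ t).
  exact: (representable_in (classifier_monic tC)).
apply: representable_and.
- have := @representable_all_imp E (T1 × power X) X
    (fun S z x => mem x (pr2 ∘ z)) (fun S z x => pr1 ∘ z ∈ t).
  move/(_ _ _)/representable_ext; apply.
  + by apply: mem_representable; naturality.
  + by apply: ct; naturality.
  + by move=> S z; split=> all S' g x; move: (all S' g x); cat.
- have := @representable_imp E (T1 × power X)
    (fun S z => pr1 ∘ z ∈ t) (fun S z => pr2 ∘ z ∈ sg).
  move/(_ _ _)/representable_ext; apply.
  + by apply: ct; naturality.
  + by apply: representable_in (singleton_monic sgP) _; naturality.
  + by move=> S z; split=> imp S' g; move: (imp S' g); cat.
Qed.

Lemma partial_element_object :
  exists P (c : Hom P T1) (s : Hom P (power X)),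
  [/\ is_partial_element c s, monic ⟨c, s⟩ &
    forall S (c' : Hom S T1) (s' : Hom S (power X)), is_partial_element c' s' ->
      exists z : Hom S P, c ∘ z = c' /\ s ∘ z = s'].
Proof.
have [P [w [mw wP]]] := representable_comprehension partial_element_representable.
exists P, (pr1 ∘ w), (pr2 ∘ w); split.
- by apply/wP; exists (idm P); cat.
- by cat.
- move=> S c' s' cs'; have /wP [z wz] : is_partial_element (pr1 ∘ ⟨c', s'⟩) (pr2 ∘ ⟨c', s'⟩).
    by cat.
  by exists z; rewrite !comp_assocr wz; cat.
Qed.

Lemma partial_map_is_partial_element A B (k : Hom A B) (x : Hom A X) (c : Hom B T1)
    (s : Hom B (power X)) :
  monic k -> classifies t c k ->
  (forall S (b : Hom S B) (z : Hom S X), mem z (s ∘ b) <-> ⟨b, z⟩ ∈ ⟨k, x⟩) ->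
  is_partial_element c s.
Proof.
move=> mk ck sP; split.
- move=> S g z /sP [a]; rewrite pair_comp => /pair_inj [ka _].
  by apply/ck; exists a.
- move=> S g /ck [a <-]; exists (x ∘ a); apply: power_ext => S' h z.
  rewrite !comp_assocr sgP sP; split.
  + by move=> <-; exists (a ∘ h); cat.
  + by case=> a'; rewrite pair_comp => /pair_inj [/mk -> <-].
Qed.

Section TotalElements.
Variables (P : E) (c : Hom P T1) (s : Hom P (power X)) (eta : Hom X P).
Hypotheses (cs : is_partial_element c s) (mcs : monic ⟨c, s⟩).
Hypotheses (ct : c ∘ eta ∈ t) (se : s ∘ eta = sg).

Lemma total_element_eq S (z : Hom S P) (x : Hom S X) :
  c ∘ z ∈ t -> s ∘ z = sg ∘ x -> z = eta ∘ x.
Proof.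
move=> cz sz; apply: mcs; rewrite !pair_comp sz -se !comp_assoc.
congr pair; apply: (classifier_true_unique tC) cz _; exact: sub_le_comp.
Qed.

Lemma total_elements_classified : classifies t c eta.
Proof.
move=> S z; split=> [cz | [x <-]]; last by rewrite comp_assoc; apply: sub_le_comp.
by have [_ /(_ S z cz) [x sx]] := cs; exists x; rewrite -(total_element_eq cz).
Qed.

Lemma mem_partial_element S (z : Hom S P) (x : Hom S X) : mem x (s ∘ z) <-> z = eta ∘ x.
Proof.
split=> [sx | ->]; last by rewrite comp_assoc se; apply/sgP.
have [sc sing] := cs; have cz := sc S z x sx; have [y sy] := sing S z cz.
by move: sx; rewrite -sy => /sgP <-; apply: total_element_eq.
Qed.

Lemma partial_element_ext B (a a' : Hom B P) :
  (forall S (b : Hom S B) (x : Hom S X), a ∘ b = eta ∘ x <-> a' ∘ b = eta ∘ x) -> a = a'.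
Proof.
move=> aa'; apply: mcs; rewrite !pair_comp; congr pair.
- apply: (classifier_ext tC) => S b; rewrite !comp_assocr !total_elements_classified.
  by split=> -[x e]; exists x; symmetry; apply/aa'.
- by apply: power_ext => S b x; rewrite !comp_assocr !mem_partial_element.
Qed.

End TotalElements.

End PartialElements.

Lemma partial_map_classifier_exists X : is_dominance C ->
  exists X' (eta : Hom X X'), is_partial_map_classifier eta.
Proof.
move=> dC; have [T0 [T1 [t tC]]] := dominance_classifier dC; have mt := classifier_monic tC.
have [sg sgP] := singleton_exists X; have msg := singleton_monic sgP.
have [P [c [s [cs mcs ex]]]] := partial_element_object tC sgP.
have [c1 c1P] := classifier_char tC (dominance_idm X dC).
have c1t : c1 ∈ t by rewrite -[c1]comp_idr; apply/c1P; exists (idm X); cat.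
have [|eta [ce se]] := ex X c1 sg.
  by split=> S g; [move=> x _; apply: sub_le_comp | exists g].
have ct : c ∘ eta ∈ t by rewrite ce.
have meta : monic eta by move=> S x y e; apply: msg; rewrite -se !comp_assocr e.
exists P, eta; split.
  have [e pb] := classifies_pullback mt meta (total_elements_classified tC cs mcs ct se).
  exact: (dom_pullback dC pb (classifier_mem tC)).
move=> A B k x ck; have mk := dom_monic dC ck.
have mkx : monic ⟨k, x⟩ by move=> S y z; rewrite !pair_comp => /pair_inj [/mk].
have [c' c'P] := classifier_char tC ck.
have [|s' s'P] := @power_comprehension E B X (fun S b z => ⟨b, z⟩ ∈ ⟨k, x⟩)
  (representable_in (a := fun S y => ⟨pr1 ∘ y, pr2 ∘ y⟩) mkx _).
  by naturality.
have [a [ca sa]] := ex B c' s' (partial_map_is_partial_element sgP mk c'P s'P).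
have aP S (b : Hom S B) (z : Hom S X) : a ∘ b = eta ∘ z <-> ⟨b, z⟩ ∈ ⟨k, x⟩.
  by rewrite -(mem_partial_element tC sgP cs mcs ct se) comp_assoc sa s'P.
exists a; split; first exact/(is_pullback_graph _ _ mkx).
move=> a' /(is_pullback_graph _ _ mkx) a'P.
by apply: (partial_element_ext tC sgP cs mcs ct se) => S b z; rewrite aP a'P.
Qed.

End PartialMaps.

Section Factorization.
Variables (E : Topos) (C : MorClass E).
Implicit Types A B S X Y Z : E.

(* When [eta] classifies partial maps, [Z] consists of the pairs [(y, a)] with [a] a
   partial element of the fibre of [f] over [y]. *)
Lemma partial_fibre_object X X' Y (eta : Hom X X') (f : Hom X Y) :
  exists Z (y : Hom Z Y) (a : Hom Z X'), monic ⟨y, a⟩ /\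
    forall S (y' : Hom S Y) (a' : Hom S X'), ⟨y', a'⟩ ∈ ⟨y, a⟩ <->
      forall S' (g : Hom S' S) (x : Hom S' X), a' ∘ g = eta ∘ x -> f ∘ x = y' ∘ g.
Proof.
have := @representable_all_imp E (Y × X') X (fun S z x => pr2 ∘ z = eta ∘ x)
  (fun S z x => f ∘ x = pr1 ∘ z).
case/(_ _ _)/representable_comprehension; try by apply: representable_eq; naturality.
move=> Z [w [mw wP]]; exists Z, (pr1 ∘ w), (pr2 ∘ w); rewrite pair_pr_comp.
split=> // S y' a'; rewrite wP.
by split=> fibre S' g x; move: (fibre S' g x); cat.
Qed.

Lemma cof_trivial_fibration_factor X Y (f : Hom X Y) : is_dominance C ->
  exists Z (u : Hom X Z) (p : Hom Z Y), [/\ C u, trivial_fibration C p & p ∘ u = f].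
Proof.
move=> dC; have [X' [eta [ceta univ]]] := partial_map_classifier_exists X dC.
have [Z [y [a [mya yaP]]]] := partial_fibre_object eta f.
have [u] : ⟨f, eta⟩ ∈ ⟨y, a⟩ by apply/yaP => S g x /(dom_monic dC ceta) ->.
rewrite pair_comp => /pair_inj [yu au].
have fibre S (z : Hom S Z) x : a ∘ z = eta ∘ x -> f ∘ x = y ∘ z.
  have /yaP/(_ S (idm S) x) : ⟨y ∘ z, a ∘ z⟩ ∈ ⟨y, a⟩ by exists z; rewrite pair_comp.
  by cat.
exists Z, u, y; split=> //.
- apply: (dom_pullback dC (f := a) (u := eta) (q := idm X)) ceta.
  split; first by rewrite au comp_idr.
  move=> S z x az; exists x; split; last by move=> h [_ <-]; rewrite comp_idl.
  split; last exact: comp_idl.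
  by apply: mya; rewrite !pair_comp !comp_assoc yu au az (fibre S z).
- move=> A B v cv z b e; have [A' [k [x pb]]] := pullback_exists (a ∘ z) eta.
  have ck : C k := dom_pullback dC pb ceta; have [azk _] := pb.
  have [c [cpb _]] := univ _ _ (v ∘ k) x (dom_comp dC ck cv).
  have [d] : ⟨b, c⟩ ∈ ⟨y, a⟩.
    apply/yaP => S g x' /(proj2 cpb) [h [[<- <-] _]].
    by rewrite (fibre S (z ∘ (k ∘ h))) !comp_assoc ?e ?azk.
  rewrite pair_comp => /pair_inj [yd ad]; exists d; split=> //.
  have cv_az : c ∘ v = a ∘ z.
    have [a' [_ a'_uniq]] := univ _ _ k x ck.
    rewrite -(a'_uniq _ pb); symmetry; apply: a'_uniq.
    exact: pullback_restrict (dom_monic dC cv) cpb.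
  by apply: mya; rewrite !pair_comp !comp_assoc yd ad e cv_az.
Qed.

End Factorization.

Section MappingPath.
Variables (E : Topos) (I : Interval E) (C : MorClass E) (hC : cofibration_class I C).
Implicit Types A B S T X Y Z P : E.

(* [P] is [X ×_Y Y^I], presented by its universal property. *)
Record is_mapping_path X Y (f : Hom X Y) P (q : Hom P X) (l : Hom (I × P) Y) : Prop := {
  mapping_path_start : forall S (z : Hom S P), l ∘ ⟨vertex I false S, z⟩ = f ∘ (q ∘ z);
  mapping_path_lift : forall S (x : Hom S X) (m : Hom (I × S) Y),
    m ∘ at_end I false S = f ∘ x -> exists h : Hom S P, q ∘ h = x /\ extends h m l;
  mapping_path_ext : forall S (h h' : Hom S P), q ∘ h = q ∘ h' ->
    (forall S' (t : Hom S' I) (z : Hom S' S), l ∘ ⟨t, h ∘ z⟩ = l ∘ ⟨t, h' ∘ z⟩) -> h = h'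
}.

Lemma mapping_path_exists X Y (f : Hom X Y) :
  exists P (q : Hom P X) (l : Hom (I × P) Y), is_mapping_path f q l.
Proof.
have [P [q [m pb]]] := pullback_exists f (ev I Y ∘ ⟨idm _, vertex I false (exp I Y)⟩).
have [e univ] := pb; exists P, q, (ev I Y ∘ ⟨m ∘ pr2, pr1⟩); split.
- by move=> S z; cat; rewrite (comp_assoc f) e; cat.
- move=> S x n nx; have [n' n'E] := curry (n ∘ ⟨pr2, pr1⟩).
  have [|h [[qh mh] _]] := univ S x n'.
    by rewrite -nx; cat; rewrite -[n']comp_idr n'E; cat.
  by exists h; split=> // S' t z; cat; rewrite (comp_assoc m) mh n'E; cat.
- move=> S h h' eq em; apply: (pullback_ext pb) => //.
  by apply: exp_ext => S' z t; move: (em S' t z); cat.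
Qed.

Lemma mapping_path_homotopy_equivalence X Y (f : Hom X Y) P (q : Hom P X) l :
  is_mapping_path f q l ->
  exists r, homotopy_equivalence I r /\ l ∘ at_end I true P ∘ r = f.
Proof.
move=> fP; have [|r [qr lr]] := mapping_path_lift fP (x := idm X) (m := f ∘ pr2).
  by cat.
exists r; split; last by apply: hom_ext => S x; cat; rewrite lr; cat.
exists q; split; first by rewrite qr; apply: homotopic_refl.
have [|G [qG lG]] := mapping_path_lift fP (x := q ∘ pr2)
  (m := l ∘ ⟨meet I ∘ ⟨pr1, pr1 ∘ pr2⟩, pr2 ∘ pr2⟩).
  by cat; rewrite (mapping_path_start fP).
have qGE S (y : Hom S (I × P)) : q ∘ (G ∘ y) = q ∘ (pr2 ∘ y) by rewrite comp_assoc qG; cat.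
apply/homotopicP; exists G; split=> S z; apply: (mapping_path_ext fP).
- by rewrite qGE !comp_assoc qr; cat.
- by move=> S' t y; cat; rewrite lG lr; cat; rewrite (mapping_path_start fP).
- by rewrite qGE; cat.
- by move=> S' t y; cat; rewrite lG; cat.
Qed.

Lemma mapping_path_fibration X Y (f : Hom X Y) P (q : Hom P X) l :
  fibrant I C X -> fibrant I C Y -> is_mapping_path f q l ->
  fibration I C (l ∘ at_end I true P).
Proof.
move=> fX fY fP; apply: (lift_extensions_fibration (I := I)) => i A Z u x k h cu px [ph hx].
have [||y [[_ yx] yh]] := fibration_lift_extensions hC fX (i := i) (u := u) (h := q ∘ h)
  (x := q ∘ x) (k := bang _) cu; first exact: one_ext.
  by apply: homotopy_lift_bang => S a; cat; rewrite hx; cat.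
have hxE S (a : Hom S A) : h ∘ ⟨vertex I i S, a⟩ = x ∘ (u ∘ a) by rewrite hx comp_assocr.
have phE S (t : Hom S I) (a : Hom S A) : l ∘ ⟨vertex I true S, h ∘ ⟨t, a⟩⟩ = k ∘ ⟨t, u ∘ a⟩.
  by move: (ph S t a); cat.
have pxE S (z : Hom S Z) : l ∘ ⟨vertex I true S, x ∘ z⟩ = k ∘ ⟨vertex I i S, z⟩.
  by move/(f_equal (fun f => f ∘ z)): px; cat.
have lE := mapping_path_start fP.
have [||||d [[_ dx] ds dh]] := fibration_lift_boundary hC (i := i) (k := bang _)
    (x := l ∘ ⟨pr1, x ∘ pr2⟩) (s := fun e : bool => if e then k else f ∘ y)
    (h := l ∘ ⟨pr1 ∘ pr2, h ∘ ⟨pr1, pr2 ∘ pr2⟩⟩) fY cu.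
- exact: one_ext.
- by case; apply: homotopy_lift_bang => S z; cat; rewrite ?pxE ?yx ?lE; cat.
- by apply: homotopy_lift_bang => S a; cat; rewrite hxE.
- by case=> S t a; cat; rewrite ?phE ?yh ?lE; cat.
- have [|D [qD lD]] := mapping_path_lift fP (x := y)
    (m := d ∘ ⟨pr1 ∘ pr2, ⟨pr1, pr2 ∘ pr2⟩⟩).
    apply: prod_hom_ext => S t z; cat.
    by have := ds false S t z; cat.
  have dE S t t' (z : Hom S Z) : l ∘ ⟨t', D ∘ ⟨t, z⟩⟩ = d ∘ ⟨t, ⟨t', z⟩⟩.
    by rewrite lD; cat.
  have qDE S (z : Hom S (I × Z)) : q ∘ (D ∘ z) = y ∘ z by rewrite comp_assoc qD.
  exists D; split; first split.
  + by move=> S t z; cat; rewrite dE; have := ds true S t z; cat.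
  + move=> S z; apply: (mapping_path_ext fP); first by rewrite qDE yx comp_assocr.
    by move=> S' t r; cat; rewrite dE dx; cat.
  + move=> S t a; apply: (mapping_path_ext fP); first by rewrite qDE yh comp_assocr.
    by move=> S' t' r; cat; rewrite dE; have := dh S' (t ∘ r) ⟨t', a ∘ r⟩; cat.
Qed.

Lemma homotopy_equivalence_fibration_factor X Y (f : Hom X Y) :
  fibrant I C X -> fibrant I C Y ->
  exists P (r : Hom X P) (p : Hom P Y),
    [/\ homotopy_equivalence I r, fibration I C p & p ∘ r = f].
Proof.
move=> fX fY; have [P [q [l fP]]] := mapping_path_exists f.
have [r [wr pr]] := mapping_path_homotopy_equivalence fP.
by exists P, r, (l ∘ at_end I true P); split=> //; apply: mapping_path_fibration fP.
Qed.

Lemma trivial_cof_fibration_factor X Y (f : Hom X Y) :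
  fibrant I C X -> fibrant I C Y ->
  exists Z (u : Hom X Z) (p : Hom Z Y),
    [/\ C u, homotopy_equivalence I u, fibration I C p & p ∘ u = f].
Proof.
move=> fX fY.
have [P [r [p [wr fp pr]]]] := homotopy_equivalence_fibration_factor f fX fY.
have [Z [u [q [cu tq qu]]]] := cof_trivial_fibration_factor r (cof_dominance hC).
have fq := trivial_fibration_fibration hC tq.
have wq := trivial_fibration_homotopy_equivalence hC tq.
have fZ := fibrant_total fq (fibrant_total fp fY).
exists Z, u, (p ∘ q); split=> //; last by rewrite comp_assocr qu.
- by apply: (homotopy_equivalence_cancell hC fZ wq); rewrite qu.
- exact: fibration_comp.
Qed.

End MappingPath.

Theorem theorem4p4 (E : Topos) (I : Interval E) (C : MorClass E)
    (hC : cofibration_class I C) :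
  @model_structure (@full_subcategory E (fibrant I C))
    (@restrict E (fibrant I C) C)
    (@restrict E (fibrant I C) (fibration I C))
    (@restrict E (fibrant I C) (homotopy_equivalence I)).
Proof.
split.
- by move=> [X fX] [Y fY] [Z fZ] f g; apply: (homotopy_equivalence_comp hC).
- by move=> [X fX] [Y fY] [Z fZ] f g; apply: (homotopy_equivalence_cancelr hC).
- by move=> [X fX] [Y fY] [Z fZ] f g; apply: (homotopy_equivalence_cancell hC).
- exact: (restrict_retract_closed (cof_retract_closed hC)).
- exact: (restrict_retract_closed (@fibration_retract_closed E I C)).
- exact: (restrict_retract_closed (@homotopy_equivalence_retract_closed E I)).
- move=> [A fA] [B fB] [X fX] [Y fY] u p cu fp wp.
  exact: (fibration_homotopy_equivalence_trivial hC fX fp wp cu).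
- move=> [A fA] [B fB] [X fX] [Y fY] u p cu wu.
  exact: (cof_homotopy_equivalence_rlp hC fA fB cu wu).
- move=> [X fX] [Y fY] f.
  have [Z [u [p [cu tp e]]]] := cof_trivial_fibration_factor f (cof_dominance hC).
  have fp := trivial_fibration_fibration hC tp.
  have wp := trivial_fibration_homotopy_equivalence hC tp.
  by exists (exist _ Z (fibrant_total fp fY)), u, p.
- move=> [X fX] [Y fY] f.
  have [Z [u [p [cu wu fp e]]]] := trivial_cof_fibration_factor hC f fX fY.
  by exists (exist _ Z (fibrant_total fp fY)), u, p.
Qed.
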